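(* Let $G(x)$ be a symmetric $m\times m$ matrix polynomial in $x\in\mathbb{R}^n$, let $g_1,\ldots,g_r$ be real polynomials in $x$, and let $\mathcal{D}=\{x\in\mathbb{R}^n: g_1(x)\ge0,\ldots,g_r(x)\ge0\}$ and $S=\{x\in\mathcal{D}:G(x)\succeq0\}$. For integers $N\ge d$ let $L_N$ be the semidefinite relaxation of $S$ of order $N$ defined in the context. Suppose $S\subseteq \mathrm{int}(\mathcal{D})$, $\mathcal{D}$ is convex, and $G(\tilde x)\succ0$ for some $\tilde x\in\mathcal{D}$. If $G(x)$ is strictly matrix concave on $\mathcal{D}$ and the archimedean condition holds for $\mathcal{D}$, then $S=L_N$ for all $N$ big enough (i.e. there is an integer $N^*\ge d$ such that $S=L_N$ for every integer $N\ge N^*$).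
   Context: $\mathbb{N}$ is the set of nonnegative integers; for $\alpha\in\mathbb{N}^n$, $|\alpha|=\alpha_1+\cdots+\alpha_n$, $x^\alpha=x_1^{\alpha_1}\cdots x_n^{\alpha_n}$. $A\succeq0$ (resp. $\succ0$) means positive semidefinite (resp. definite). $\mathrm{int}$ denotes interior, $\nabla_{xx}$ the Hessian with respect to $x$. A polynomial is sos if it is a finite sum of squares of polynomials. Definition of $L_N$: put $g_0\equiv1$, $d_k=\lceil\deg(g_k)/2\rceil$ for $k=0,\ldots,r$, and $d=\max\{\deg(G)/2,\ d_0,\ldots,d_r\}$, where $\deg(G)$ is the total degree of $G$. Write $G(x)=\sum_\alpha G_\alpha x^\alpha$ with constant symmetric matrices $G_\alpha$. Let $[x]_t$ be the column vector of all monomials in $x$ of degree at most $t$. For an integer $N\ge d$ and $k=0,\ldots,r$, let $B^{(N)}_{k,\beta}$ be the symmetric matrices determined by $g_k(x)[x]_{N-d_k}[x]_{N-d_k}^T=\sum_{|\beta|\le 2N}x^\beta B^{(N)}_{k,\beta}$. For a vector $y\in\mathbb{R}^{\binom{n+2N}{n}}$ indexed by the $\beta\in\mathbb{N}^n$ with $|\beta|\le2N$, set $\mathcal{G}(y)=\sum_\alpha y_\alpha G_\alpha$ and $B_k^{(N)}(y)=\sum_{|\beta|\le2N}y_\beta B^{(N)}_{k,\beta}$. Then $$L_N=\Big\{x\in\mathbb{R}^n:\ \exists\,y\in\mathbb{R}^{\binom{n+2N}{n}},\ y_0=1,\ x_1=y_{e_1},\ldots,x_n=y_{e_n},\ \mathcal{G}(y)\succeq0,\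 B_k^{(N)}(y)\succeq0,\ k=0,\ldots,r\Big\},$$ where $e_i$ is the $i$-th standard unit vector. $G$ is strictly matrix concave on $\mathcal{D}$ if for every $0\ne\xi\in\mathbb{R}^m$ one has $-\nabla_{xx}(\xi^TG(x)\xi)\succ0$ for all $x\in\mathcal{D}$. The archimedean condition for $\mathcal{D}$: there exist $M>0$ and sos polynomials $s_0,s_1,\ldots,s_r$ such that $M-\|x\|_2^2=s_0+g_1s_1+\cdots+g_rs_r$. *)

(* Defs.v *)
From HB Require Import structures.
From mathcomp Require Import all_boot all_order all_algebra.
From mathcomp Require Import mpoly.
From mathcomp Require Import classical_sets reals topology convex.

Set Implicit Arguments.
Unset Strict Implicit.
Unset Printing Implicit Defensive.

Import Order.TTheory GRing.Theory Num.Theory.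

Local Open Scope classical_set_scope.
Local Open Scope ring_scope.

Section Matrices.
Variable R : realType.

Definition psd m (A : 'M[R]_m) : Prop :=
  A^T = A /\ forall v : 'cV[R]_m, 0 <= (v^T *m A *m v) 0 0.

Definition posdef m (A : 'M[R]_m) : Prop :=
  A^T = A /\ forall v : 'cV[R]_m, v != 0 -> 0 < (v^T *m A *m v) 0 0.

End Matrices.

Section Polynomials.
Variables (R : realType) (n : nat).

Definition evalp (p : {mpoly R[n]}) (x : 'rV[R]_n) : R := p.@[fun i => x 0 i].

Definition evalmx m (G : 'M[{mpoly R[n]}]_m) (x : 'rV[R]_n) : 'M[R]_m :=
  map_mx (fun p => evalp p x) G.

(* [msize] is one more than the degree, except that [msize 0 = 0]; the zero
   polynomial is thus given degree 0. *)
Definition mpdeg (p : {mpoly R[n]}) : nat := (msize p).-1.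

Definition mxdeg m (G : 'M[{mpoly R[n]}]_m) : nat :=
  (\max_(i < m) \max_(j < m) mpdeg (G i j))%N.

Definition sos (p : {mpoly R[n]}) : Prop :=
  exists s : seq {mpoly R[n]}, p = \sum_(q <- s) q ^+ 2.

Definition hessian (p : {mpoly R[n]}) (x : 'rV[R]_n) : 'M[R]_n :=
  \matrix_(i, j) evalp (mderiv j (mderiv i p)) x.

Definition quadform m (G : 'M[{mpoly R[n]}]_m) (xi : 'cV[R]_m) :
    {mpoly R[n]} :=
  let xip := map_mx (@mpolyC n R) xi in (xip^T *m G *m xip) 0 0.

Definition strictly_matrix_concave m (G : 'M[{mpoly R[n]}]_m)
    (D : set 'rV[R]_n) : Prop :=
  forall xi : 'cV[R]_m, xi != 0 ->
  forall x, D x -> posdef (- hessian (quadform G xi) x).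

End Polynomials.

Section Relaxation.
Variables (R : realType) (n m r : nat).
Variables (G : 'M[{mpoly R[n]}]_m) (g : 'I_r -> {mpoly R[n]}).

(* Index 0 stands for the constant 1 and index k.+1 for [g k], so that [g k]
   here is the g_(k+1) of the usual numbering g_1, ..., g_r. *)
Definition gext (k : 'I_r.+1) : {mpoly R[n]} := oapp g 1 (unlift ord0 k).

Definition domD : set 'rV[R]_n := [set x | forall k, 0 <= evalp (g k) x].

Definition setS : set 'rV[R]_n := [set x | domD x /\ psd (evalmx G x)].

Definition archimedean : Prop :=
  exists M : R, 0 < M /\
  exists (s0 : {mpoly R[n]}) (s : 'I_r -> {mpoly R[n]}),
    [/\ sos s0, forall k, sos (s k) &
        mpolyC n M - \sum_(i < n) 'X_i ^+ 2 = s0 + \sum_(k < r) g k * s k].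

Definition dk (k : 'I_r.+1) : nat := uphalf (mpdeg (gext k)).

(* Rational-valued, since deg(G)/2 is not rounded. *)
Definition order_bound : rat :=
  \big[Num.max/(mxdeg G)%:R / 2]_(k < r.+1) (dk k)%:R.

(* The monomials are listed in the arbitrary order of [enum_val]. *)
Definition monomials (t : nat) :
    'cV[{mpoly R[n]}]_#|{: 'X_{1..n < t.+1}}| :=
  \col_i 'X_[bmnm (enum_val i)].

Definition Bcoef (N : nat) (k : 'I_r.+1) (b : 'X_{1..n}) :
    'M[R]_#|{: 'X_{1..n < (N - dk k).+1}}| :=
  map_mx (mcoeff b)
    (gext k *: (monomials (N - dk k) *m (monomials (N - dk k))^T)).

Definition Bmx (N : nat) (k : 'I_r.+1) (y : 'X_{1..n < (2 * N).+1} -> R) :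
    'M[R]_#|{: 'X_{1..n < (N - dk k).+1}}| :=
  \sum_(b : 'X_{1..n < (2 * N).+1}) y b *: Bcoef N k b.

(* Summing over degree at most 2N exhausts the monomials of G as soon as
   [order_bound <= N]. *)
Definition Gmx (N : nat) (y : 'X_{1..n < (2 * N).+1} -> R) : 'M[R]_m :=
  \sum_(a : 'X_{1..n < (2 * N).+1}) y a *: map_mx (mcoeff (bmnm a)) G.

(* [y] is indexed by the exponents of degree at most 2N; quantifying over the
   index [b] equal to 0 (resp. to e_i) avoids carrying the proof that this
   exponent is within the bound. *)
Definition setL (N : nat) : set 'rV[R]_n :=
  [set x | exists y : 'X_{1..n < (2 * N).+1} -> R,
     [/\ forall b : 'X_{1..n < (2 * N).+1}, bmnm b = 0%MM -> y b = 1,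
         forall (i : 'I_n) (b : 'X_{1..n < (2 * N).+1}),
           bmnm b = U_(i)%MM -> x 0 i = y b,
         psd (Gmx y) &
         forall k, psd (Bmx k y)]].

End Relaxation.

(* Main.v *)
Require Import Defs.
From HB Require Import structures.
From mathcomp Require Import all_boot all_order all_algebra.
From mathcomp Require Import mpoly.
From mathcomp Require Import boolp classical_sets reals topology.
From mathcomp Require Import normedtype derive convex.
From mathcomp Require Import polyrcf ring lra zify.

Set Implicit Arguments.
Unset Strict Implicit.
Unset Printing Implicit Defensive.

Import Order.TTheory GRing.Theory Num.Theory.
Import numFieldTopology.Exports numFieldNormedType.Exports.

Local Open Scope classical_set_scope.
Local Open Scope ring_scope.

(** The inclusion of S in L_N is the remark that the monomials of a point of S
    form a feasible moment vector.  For the converse, let L be the Riesz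
    functional of a feasible vector y of order N, and x the point with
    coordinates L(X_i).

    Suppose x is not in S, and walk from a Slater point xt towards x.  Let u be
    the last point of D on the way.  It is not in S: either it is x, or else it
    would be interior to D and the walk could go on.  So f(u) < 0 for some f = xi^T G xi with xi a unit
    vector, while f(xt) >= 0, and L(f) >= 0 because G(y) is positive
    semidefinite.  Were L the integration against a probability measure on D,
    concavity of f would give

      L(f) <= f(u) + grad f(u) . (x - u)
      f(xt) <= f(u) + grad f(u) . (xt - u),

    so that f would have to increase from u in two opposite directions
    ([setL_sub_setS]).  The proof consists in obtaining the first inequality for
    pseudo-moments of a finite order that does not depend on u and xi.

    The polynomial phi(s) = L(f((1 - s) u + s X)) satisfies phi(0) = f(u),
    phi'(0) = grad f(u) . (x - u) and phi(1) = L(f), so it is enough that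
    phi'' <= 0 on [0, 1] ([gradient_ineq]).  Now - phi''(s) = L(w^T A w), where
    w = X - u and A = - Hess f((1 - s) u + s X) is a matrix polynomial in X,
    positive definite on the convex set D.  Its sign follows from a
    Putinar certificate for A whose degree is uniform in the parameters
    (u, s, xi) ([hessian_functional]), found in three steps.

    - Compactness gives one polynomial q of the quadratic module and one e > 0
      such that A - q I >= e I for all parameters, on a whole box around D
      instead of D alone ([curvature_penalty]).
    - On the box, the Bernstein coefficients of A - q I of a large degree k are
      close to its values at grid points, hence positive semidefinite, and k
      depends only on e and on a bound for the coefficients
      ([psd_box_certificate]).
    - The Bernstein basis consists of products of the polynomials c +- X_i,
      which belong to the preorder generated by M - |X|^2, and this preorder is
      part of the quadratic module by the archimedean condition
      ([bernM_preorder1]).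

    Thus - phi''(s) is a sum of numbers L(p l^2) with l affine and p in a finite
    list of elements of the quadratic module; these are nonnegative as soon as
    N is large ([riesz_quad_modules]). *)

(** * Sums of squares and quadratic modules *)

Section SumsOfSquares.
Variables (R : realType) (n : nat).
Implicit Types p q : {mpoly R[n]}.

Lemma mpoly_ring_ind (P : {mpoly R[n]} -> Prop) :
  (forall c, P c%:MP) -> (forall i, P 'X_i) ->
  (forall p q, P p -> P q -> P (p + q)) ->
  (forall p q, P p -> P q -> P (p * q)) -> forall p, P p.
Proof.
move=> PC PX PD PM; have PXm (m : 'X_{1..n}) : P 'X_[m].
  rewrite mpolyXE_id; apply: (big_ind P) => [|//|i _]; first exact: (PC 1).
  by elim: (m i) => [|k IH]; [exact: (PC 1) | rewrite exprS; apply: PM].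
elim/mpolyind => [|c m p _ _ IHp]; first by rewrite -mpolyC0.
by apply: PD => //; rewrite -mul_mpolyC; apply: PM.
Qed.

Lemma sos_sqr p : sos (p ^+ 2).
Proof. by exists [:: p]; rewrite big_seq1. Qed.

Lemma sosD p q : sos p -> sos q -> sos (p + q).
Proof. by move=> [s ->] [t ->]; exists (s ++ t); rewrite big_cat. Qed.

Lemma sosC (c : R) : 0 <= c -> sos (c%:MP : {mpoly R[n]}).
Proof.
move=> c0; rewrite -(sqr_sqrtr c0) expr2 mpolyCM -expr2; exact: sos_sqr.
Qed.

Lemma sos0 : sos (0 : {mpoly R[n]}).
Proof. by exists [::]; rewrite big_nil. Qed.

Lemma sos1 : sos (1 : {mpoly R[n]}).
Proof. by rewrite -(expr1n _ 2); apply: sos_sqr. Qed.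

Lemma sos_sum (I : Type) (s : seq I) (F : I -> {mpoly R[n]}) :
  (forall i, sos (F i)) -> sos (\sum_(i <- s) F i).
Proof. by move=> sF; apply: (big_ind (@sos R n)) => //; [apply: sos0|apply: sosD]. Qed.

Lemma sosM p q : sos p -> sos q -> sos (p * q).
Proof.
move=> [s ->] [t ->]; rewrite big_distrl; apply: sos_sum => a /=.
rewrite big_distrr; apply: sos_sum => b /=.
by rewrite -exprMn; apply: sos_sqr.
Qed.

(** With a single generator the quadratic module is closed under products, since
    the square of the generator is a square. *)
Definition preorder1 (rho p : {mpoly R[n]}) : Prop :=
  exists sigma tau, [/\ sos sigma, sos tau & p = sigma + rho * tau].

Lemma preorder1_sos rho p : sos p -> preorder1 rho p.
Proof. by move=> sp; exists p, 0; rewrite mulr0 addr0; split=> //; apply: sos0. Qed.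

Lemma preorder1_gen rho : preorder1 rho rho.
Proof.
exists 0, 1; rewrite mulr1 add0r; split=> //; [exact: sos0|exact: sos1].
Qed.

Lemma preorder1D rho p q :
  preorder1 rho p -> preorder1 rho q -> preorder1 rho (p + q).
Proof.
move=> [s [t [ss st ->]]] [s' [t' [ss' st' ->]]].
by exists (s + s'), (t + t'); split; [apply: sosD|apply: sosD|ring].
Qed.

Lemma preorder1M rho p q :
  preorder1 rho p -> preorder1 rho q -> preorder1 rho (p * q).
Proof.
move=> [s [t [ss st ->]]] [s' [t' [ss' st' ->]]].
exists (s * s' + rho ^+ 2 * (t * t')), (s * t' + t * s'); split; last by ring.
  by apply: sosD; apply: sosM => //; [apply: sos_sqr|apply: sosM].
by apply: sosD; apply: sosM.
Qed.

Lemma preorder1Z rho (c : R) p : 0 <= c -> preorder1 rho p -> preorder1 rho (c *: p).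
Proof.
move=> c0 Tp; rewrite -mul_mpolyC; apply: preorder1M => //.
by apply: preorder1_sos; apply: sosC.
Qed.

Lemma preorder1X rho p k : preorder1 rho p -> preorder1 rho (p ^+ k).
Proof.
move=> Tp; elim: k => [|k IH]; last by rewrite exprS; apply: preorder1M.
by rewrite expr0; apply: preorder1_sos; apply: sos1.
Qed.

(** For |X|^2 <= M <= c^2, the sign of c +- X_i is visible on the identity
    2 c (c +- X_i) = (c +- X_i)^2 + (c^2 - M) + sum_(j != i) X_j^2 + (M - |X|^2). *)
Lemma preorder1_box (M c : R) (i : 'I_n) (b : bool) : 0 < c -> M <= c ^+ 2 ->
  preorder1 (mpolyC n M - \sum_(i < n) 'X_i ^+ 2) (c%:MP + (-1) ^+ b *: 'X_i).
Proof.
move=> c0 Mc; set rho := (X in preorder1 X _).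
have rhoE : rho = M%:MP - ('X_i ^+ 2 + \sum_(j < n | j != i) 'X_j ^+ 2).
  by rewrite /rho (bigD1 i).
have -> : c%:MP + (-1) ^+ b *: 'X_i = (2 * c)^-1 *:
    ((c%:MP + (-1) ^+ b *: 'X_i) ^+ 2 + (c ^+ 2 - M)%:MP
     + \sum_(j < n | j != i) 'X_j ^+ 2 + rho) :> {mpoly R[n]}.
  apply: (canRL (scalerK _)).
    by rewrite mulf_neq0 ?pnatr_eq0 // gt_eqF.
  rewrite rhoE -!mul_mpolyC mpolyCB expr2 !mpolyCM mpolyCD rmorphXn /= mpolyCN.
  by case: b; rewrite ?expr0 ?expr1 mpolyC1; ring.
apply: preorder1Z; first by rewrite invr_ge0 mulr_ge0 // ltW.
apply: preorder1D (preorder1_gen _); apply: preorder1_sos.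
do 2 ?apply: sosD; [exact: sos_sqr| by apply: sosC; rewrite subr_ge0|].
rewrite -big_filter; apply: sos_sum => j; exact: sos_sqr.
Qed.

End SumsOfSquares.

Section QuadraticModule.
Variables (R : realType) (n r : nat) (g : 'I_r -> {mpoly R[n]}).
Implicit Types p q : {mpoly R[n]}.

Definition quad_module p : Prop :=
  exists s : 'I_r.+1 -> {mpoly R[n]},
    (forall k, sos (s k)) /\ p = \sum_k gext g k * s k.

Lemma quad_moduleD p q : quad_module p -> quad_module q -> quad_module (p + q).
Proof.
move=> [s [ss ->]] [t [st ->]]; exists (fun k => s k + t k).
split; first by move=> k; apply: sosD.
by rewrite -big_split; apply: eq_bigr => k _; rewrite mulrDr.
Qed.

Lemma quad_moduleMsos p q : quad_module p -> sos q -> quad_module (p * q).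
Proof.
move=> [s [ss ->]] sq; exists (fun k => s k * q).
split; first by move=> k; apply: sosM.
by rewrite big_distrl; apply: eq_bigr => k _; rewrite mulrA.
Qed.

Lemma quad_module_gen k : quad_module (gext g k).
Proof.
exists (fun l => ((l == k)%:R : R)%:MP); split.
  by move=> l; apply: sosC; apply: ler0n.
rewrite (bigD1 k) //= eqxx mulr1 big1 ?addr0 // => l /negPf ->.
by rewrite mulr0.
Qed.

Lemma gext0 : gext g ord0 = 1.
Proof. by rewrite /gext unlift_none. Qed.

Lemma gextS k : gext g (lift ord0 k) = g k.
Proof. by rewrite /gext liftK. Qed.

Lemma quad_module_sos p : sos p -> quad_module p.
Proof.
move=> sp; rewrite -[p]mul1r -gext0.
by apply: quad_moduleMsos => //; apply: quad_module_gen.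
Qed.

Lemma quad_module_sum (I : Type) (s : seq I) (F : I -> {mpoly R[n]}) :
  (forall i, quad_module (F i)) -> quad_module (\sum_(i <- s) F i).
Proof.
move=> sF; apply: (big_ind quad_module) => //; last exact: quad_moduleD.
by apply: quad_module_sos; apply: sos0.
Qed.

Lemma quad_module_preorder1 rho p :
  quad_module rho -> preorder1 rho p -> quad_module p.
Proof.
move=> qrho [s [t [ss st ->]]]; apply: quad_moduleD.
  exact: quad_module_sos.
exact: quad_moduleMsos.
Qed.

End QuadraticModule.

(** * Bernstein expansions *)

Section Bernstein.
Variable R : realType.

Definition bern (A : comAlgType R) k (j : nat) (t : A) : A :=
  'C(k, j)%:R *: (t ^+ j * (1 - t) ^+ (k - j)).

Definition bernM (A : comAlgType R) n k (nu : {ffun 'I_n -> 'I_k.+1})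
  (t : 'I_n -> A) : A := \prod_i bern k (nu i) (t i).

(** Both sides count the pairs of disjoint parts, the first one ordered and of
    size j, the second of size i, in a set of size j + l. *)
Lemma ffact_bin_shift j l i : (i <= l)%N ->
  ((j + i) ^_ j * 'C(j + l, j + i) = (j + l) ^_ j * 'C(l, i))%N.
Proof.
move=> il; apply/eqP.
have p0 : (0 < i`! * (l - i)`!)%N by rewrite muln_gt0 !fact_gt0.
rewrite -(eqn_pmul2r p0).
have h1 : ((j + i) ^_ j * i`! = (j + i)`!)%N.
  by rewrite -[i in i`!](addKn j) ffact_fact // leq_addr.
have h2 : ((j + l) ^_ j * l`! = (j + l)`!)%N.
  by rewrite -[l in l`!](addKn j) ffact_fact // leq_addr.
have h3 : ('C(l, i) * (i`! * (l - i)`!) = l`!)%N by rewrite bin_fact.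
have h4 : ('C(j + l, j + i) * ((j + i)`! * (l - i)`!) = (j + l)`!)%N.
  by rewrite -[(l - i)%N](subnDl j) bin_fact // leq_add2l.
by rewrite -[((j + l) ^_ j * _ * _)%N]mulnA h3 h2 -h4 -h1; apply/eqP; ring.
Qed.

(** Multiplying the binomial expansion of (t + (1 - t))^(k - j) by t^j. The
    expansion is exact, whereas sampling t^j at v / k would leave a remainder
    polynomial to control. *)
Lemma bern_monomial (A : comAlgType R) k j (t : A) : (j <= k)%N ->
  t ^+ j = \sum_(v < k.+1) ((v ^_ j)%:R / (k ^_ j)%:R) *: bern k v t.
Proof.
move=> jk; have kj0 : (k ^_ j)%:R != 0 :> R by rewrite pnatr_eq0 -lt0n ffact_gt0.
apply: (scalerI kj0); rewrite scaler_sumr.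
under eq_bigr => v _ do
  rewrite scalerA mulrC divfK // /bern scalerA -natrM.
have [l kE] : exists l, k = (j + l)%N by exists (k - j)%N; rewrite subnKC.
rewrite kE in kj0 jk *; rewrite -addnS big_split_ord /= big1 ?add0r; last first.
  by move=> i _; rewrite ffact_small // mul0n scale0r.
under eq_bigr => i _.
  rewrite ffact_bin_shift -1?ltnS ?ltn_ord // subnDl exprD -mulrA natrM -scalerA.
  rewrite scalerAr; over.
rewrite /= -scaler_sumr -mulr_sumr; congr (_ *: _); rewrite -[LHS]mulr1; congr (_ * _).
rewrite -[LHS](expr1n A l) -[X in X ^+ l](subrK t 1) exprDn.
by apply: eq_bigr => i _; rewrite scaler_nat mulrC.
Qed.

Definition bernM_coef n k (nu : {ffun 'I_n -> 'I_k.+1}) (m : 'X_{1..n}) : R :=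
  \prod_i ((nu i ^_ m i)%:R / (k ^_ m i)%:R).

Lemma bernM_monomial (A : comAlgType R) n k (t : 'I_n -> A) (m : 'X_{1..n}) :
  (forall i, (m i <= k)%N) ->
  \prod_i t i ^+ m i =
  \sum_(nu : {ffun 'I_n -> 'I_k.+1}) bernM_coef nu m *: bernM nu t.
Proof.
move=> mk; under eq_bigr => i _ do rewrite (bern_monomial _ (mk i)).
rewrite bigA_distr_bigA /=; apply: eq_bigr => nu _.
by rewrite scaler_prod.
Qed.

Lemma prod_dist (I : Type) (s : seq I) (a b : I -> R) :
  (forall i, 0 <= a i <= 1) -> (forall i, 0 <= b i <= 1) ->
  `|\prod_(i <- s) a i - \prod_(i <- s) b i| <= \sum_(i <- s) `|a i - b i|.
Proof.
move=> ha hb.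
have pa (u : seq I) : 0 <= \prod_(i <- u) a i <= 1.
  by rewrite prodr_ge0 ?prodr_ile1 // => i _; case/andP: (ha i).
elim: s => [|i s IH]; first by rewrite !big_nil subrr normr0.
rewrite !big_cons; set P := \prod_(j <- s) a j in IH *.
have -> : a i * P - b i * \prod_(j <- s) b j =
  (a i - b i) * P + b i * (P - \prod_(j <- s) b j) by ring.
apply: le_trans (ler_normD _ _) _; rewrite !normrM; apply: lerD.
  have /andP[P0 P1] : 0 <= P <= 1 := pa s.
  by rewrite ler_piMr // ger0_norm.
by apply: le_trans IH; have /andP[b0 b1] := hb i; rewrite ler_piMl // ger0_norm.
Qed.

(** The exact coefficient of t^j is close to the value of t^j at v / k: the i-th
    factors (v - i) / (k - i) and v / k differ by at most i / (k - i), also when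
    v < i and the natural subtraction truncates. *)
Lemma ffact_ratio_dist k d v j : (d < k)%N -> (v <= k)%N -> (j <= d)%N ->
  `|(v ^_ j)%:R / (k ^_ j)%:R - (v%:R / k%:R) ^+ j| <= (d ^ 2)%:R / (k - d)%:R :> R.
Proof.
move=> dk vk jd.
have k0 : 0 < (k%:R : R) by rewrite ltr0n (leq_trans _ dk).
have kd0 : 0 < ((k - d)%:R : R) by rewrite ltr0n subn_gt0.
have ki0 (i : 'I_j) : 0 < ((k - i)%:R : R).
  by rewrite ltr0n subn_gt0 (leq_trans (ltn_ord i)) // (leq_trans jd) // ltnW.
have r01 (a b : nat) : (a <= b)%N -> 0 < b%:R :> R -> 0 <= (a%:R / b%:R : R) <= 1.
  by move=> ab b0; rewrite divr_ge0 //= ler_pdivrMr // mul1r ler_nat.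
rewrite !ffact_prod !natr_prod -prodf_div.
have -> : (v%:R / k%:R) ^+ j = \prod_(i < j) (v%:R / k%:R) :> R.
  by rewrite prodr_const card_ord.
apply: le_trans (prod_dist _ _ _) _.
- by move=> i; apply: r01 => //; apply: leq_sub2r.
- by move=> i; apply: r01.
apply: le_trans (_ : \sum_(i < j) d%:R / (k - d)%:R <= _); last first.
  rewrite sumr_const card_ord -[leLHS]mulr_natl mulrA -natrM ler_pM2r ?invr_gt0 //.
  by rewrite ler_nat -mulnn leq_mul2r jd orbT.
apply: ler_sum => i _.
have id : (i <= d)%N by rewrite ltnW // (leq_trans (ltn_ord i)).
have ik : (i <= k)%N by rewrite (leq_trans id) // ltnW.
apply: le_trans (_ : i%:R / (k - i)%:R <= _); last first.
  rewrite ler_pM ?invr_ge0 ?ler_nat // lef_pV2 ?posrE // ler_nat leq_sub2l // ltnW.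
have [vi|iv] := leqP v i.
  have /eqP -> : (v - i == 0)%N by rewrite subn_eq0.
  rewrite mul0r sub0r normrN ger0_norm ?divr_ge0 //.
  rewrite ler_pM ?invr_ge0 ?ler_nat // lef_pV2 ?posrE //.
  by rewrite ler_nat leq_subr.
have -> : (v - i)%:R / (k - i)%:R - v%:R / k%:R =
   - (i%:R / (k - i)%:R) * ((k - v)%:R / k%:R) :> R.
  have := ki0 i; rewrite !natrB // 1?ltnW // => /lt0r_neq0 h.
  by field; rewrite h gt_eqF.
rewrite normrM normrN [X in X * _]ger0_norm ?divr_ge0 // ler_piMr ?divr_ge0 //.
have /andP[? ?] := r01 (k - v)%N k (leq_subr _ _) k0.
by rewrite ger0_norm.
Qed.

End Bernstein.

(** * Uniformly bounded polynomials *)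

Section BoundedFamilies.
Variables (R : realType) (n : nat) (t : 'I_n -> {mpoly R[n]}).
Implicit Types p q : {mpoly R[n]}.

Definition tpoly (s : seq (R * 'X_{1..n})) : {mpoly R[n]} :=
  \sum_(am <- s) am.1 *: \prod_i t i ^+ am.2 i.

(** A bound on the coefficients and on the degree in terms of the t_i. It asks
    for some expression in the t_i, so that sums and products of expressions
    settle the closure properties and uniqueness of coefficients is not at
    stake. *)
Definition tbounded (C : R) (d : nat) p : Prop :=
  exists s : seq (R * 'X_{1..n}), [/\ p = tpoly s,
    \sum_(am <- s) `|am.1| <= C & forall am, am \in s -> forall i, (am.2 i <= d)%N].

Lemma tboundedD C d p C' d' p' :
  tbounded C d p -> tbounded C' d' p' -> tbounded (C + C') (d + d') (p + p').
Proof.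
move=> [s [-> sC sd]] [s' [-> sC' sd']]; exists (s ++ s'); split.
- by rewrite /tpoly big_cat.
- by rewrite big_cat lerD.
- move=> am; rewrite mem_cat => /orP[/sd|/sd'] h i.
    by rewrite (leq_trans (h i)) ?leq_addr.
  by rewrite (leq_trans (h i)) ?leq_addl.
Qed.

Lemma tboundedM C d p C' d' p' : 0 <= C ->
  tbounded C d p -> tbounded C' d' p' -> tbounded (C * C') (d + d') (p * p').
Proof.
move=> C0 [s [-> sC sd]] [s' [-> sC' sd']].
exists [seq (am.1 * bm.1, (am.2 + bm.2)%MM) | am <- s, bm <- s']; split.
- rewrite /tpoly big_allpairs_dep big_distrl; apply: eq_bigr => am _ /=.
  rewrite big_distrr; apply: eq_bigr => bm _ /=.
  rewrite -scalerAl -scalerAr scalerA -big_split /=; congr (_ *: _).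
  by apply: eq_bigr => i _; rewrite mnmDE exprD.
- rewrite big_allpairs_dep /=.
  apply: le_trans (_ : (\sum_(am <- s) `|am.1|) * (\sum_(bm <- s') `|bm.1|) <= _).
    rewrite big_distrl; apply: ler_sum => am _ /=.
    by rewrite big_distrr; apply: ler_sum => bm _ /=; rewrite normrM.
  by apply: ler_pM => //; apply: sumr_ge0.
- move=> _ /allpairsP[[am bm] /= [/sd h /sd' h' ->]] i /=.
  by rewrite mnmDE leq_add.
Qed.

Lemma tboundedC (a : R) C : `|a| <= C -> tbounded C 0 a%:MP.
Proof.
move=> aC; exists [:: (a, 0%MM)]; split; rewrite /tpoly ?big_seq1 //=.
  rewrite big1 ?alg_mpolyC // => i _; first by rewrite mnm0E expr0.
by move=> am; rewrite inE => /eqP -> i; rewrite mnm0E.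
Qed.

Lemma tbounded_gen i : tbounded 1 1 (t i).
Proof.
exists [:: (1, U_(i)%MM)]; split; rewrite /tpoly ?big_seq1 /= ?normr1 //.
  rewrite scale1r (bigD1 i) //= big1 ?mulr1 ?mnm1E ?eqxx ?expr1 // => j ji.
  by rewrite mnm1E eq_sym (negPf ji) expr0.
by move=> am; rewrite inE => /eqP -> j; rewrite mnm1E leq_b1.
Qed.

Lemma evalpD p q (x : 'rV[R]_n) : evalp (p + q) x = evalp p x + evalp q x.
Proof. exact: mevalD. Qed.

Lemma evalpM p q (x : 'rV[R]_n) : evalp (p * q) x = evalp p x * evalp q x.
Proof. exact: mevalM. Qed.

Lemma evalpC c (x : 'rV[R]_n) : evalp c%:MP x = c.
Proof. exact: mevalC. Qed.

Lemma evalpXU i (x : 'rV[R]_n) : evalp 'X_i x = x 0 i.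
Proof. exact: mevalXU. Qed.

Lemma evalpB p q (x : 'rV[R]_n) : evalp (p - q) x = evalp p x - evalp q x.
Proof. exact: mevalB. Qed.

Lemma evalpX p k (x : 'rV[R]_n) : evalp (p ^+ k) x = evalp p x ^+ k.
Proof. exact: rmorphXn. Qed.

Lemma evalp_tpoly s (x : 'rV[R]_n) :
  evalp (tpoly s) x = \sum_(am <- s) am.1 * \prod_i evalp (t i) x ^+ am.2 i.
Proof.
rewrite /evalp /tpoly raddf_sum; apply: eq_bigr => am _ /=.
rewrite mevalZ rmorph_prod; congr (_ * _); apply: eq_bigr => i _ /=.
by rewrite rmorphXn.
Qed.

Lemma tbounded_eval C d p (x : 'rV[R]_n) :
  (forall i, 0 <= evalp (t i) x <= 1) -> tbounded C d p -> `|evalp p x| <= C.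
Proof.
move=> ht [s [-> sC _]]; rewrite evalp_tpoly.
apply: le_trans (ler_norm_sum _ _ _) _; apply: le_trans sC.
apply: ler_sum => am _; rewrite normrM ler_piMr //.
have h i : 0 <= evalp (t i) x ^+ am.2 i <= 1.
  by have /andP[h0 h1] := ht i; rewrite exprn_ge0 // exprn_ile1.
by rewrite ger0_norm ?prodr_ge0 ?prodr_ile1 // => i _; case/andP: (h i).
Qed.

(** The degree k is chosen before p: it works at once for a whole family of
    polynomials with bounded coefficients. *)
Lemma tbounded_bern C d (e : R) : 0 <= C -> 0 < e ->
  exists k : nat, (0 < k)%N /\ forall p, tbounded C d p ->
  exists beta : {ffun 'I_n -> 'I_k.+1} -> R,
    p = \sum_nu beta nu *: bernM nu t /\
    forall (nu : {ffun 'I_n -> 'I_k.+1}) (x : 'rV[R]_n),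
      (forall i, evalp (t i) x = (nu i)%:R / k%:R) ->
      `|beta nu - evalp p x| <= e.
Proof.
move=> C0 e0.
pose B : R := C * (n * d ^ 2)%:R.
have B0 : 0 <= B by rewrite mulr_ge0.
pose k := (Num.truncn (B / e)).+1; exists (d + k)%N.
split; first by rewrite addnS.
move=> p [s [-> sC sd]].
exists (fun nu : {ffun 'I_n -> 'I_(d + k).+1} =>
  \sum_(am <- s) am.1 * bernM_coef R nu am.2); split.
  rewrite /tpoly; under [RHS]eq_bigr do rewrite scaler_suml.
  rewrite exchange_big /=; apply: eq_big_seq => am /sd h.
  rewrite (bernM_monomial (k := d + k)); last first.
    by move=> i; rewrite (leq_trans (h i)) // leq_addr.
  by rewrite scaler_sumr; apply: eq_bigr => nu _; rewrite scalerA.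
move=> nu x hx; rewrite evalp_tpoly -sumrB.
apply: le_trans (ler_norm_sum _ _ _) _.
pose D : R := (n * d ^ 2)%:R / k%:R.
apply: le_trans (_ : \sum_(am <- s) `|am.1| * D <= _).
  rewrite !big_seq; apply: ler_sum => am /sd h.
  rewrite -mulrBr normrM ler_wpM2l //.
  have k0 : 0 < ((d + k)%:R : R) by rewrite ltr0n addnS.
  have r01 (a b : nat) : (a <= b)%N -> 0 <= (a%:R / b%:R : R) <= 1.
    case: b => [|b] ab.
      by move: ab; rewrite leqn0 => /eqP ->; rewrite mul0r lexx ler01.
    by rewrite divr_ge0 //= ler_pdivrMr ?ltr0n // mul1r ler_nat.
  apply: le_trans (prod_dist _ _ _) _.
  - move=> i; apply: r01; rewrite !ffact_prod; apply: leq_prod => j _.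
    by rewrite leq_sub2r // -ltnS.
  - move=> i; rewrite hx; have /andP[? ?] := r01 (nu i : nat) (d + k)%N (ltn_ord (nu i)).
    by rewrite exprn_ge0 // exprn_ile1.
  apply: le_trans (_ : \sum_(i < n) (d ^ 2)%:R / k%:R <= _); last first.
    by rewrite sumr_const card_ord -[leLHS]mulr_natl mulrA -natrM.
  apply: ler_sum => i _; rewrite hx.
  have := @ffact_ratio_dist R (d + k) d (nu i) (am.2 i).
  by rewrite addKn; apply => //; [rewrite addnS ltnS leq_addr | rewrite -ltnS].
rewrite -mulr_suml; apply: le_trans (_ : C * D <= _).
  by rewrite ler_wpM2r // divr_ge0.
rewrite mulrA ler_pdivrMr ?ltr0n //.
have := truncnS_gt (B / e); rewrite ltr_pdivrMr // => h.
by rewrite -/B mulrC ltW // -/k mulrC.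
Qed.

End BoundedFamilies.

(** * Positive semidefinite forms as sums of squares of linear forms *)
Section Cholesky.
Variables (R : realType) (n : nat).

Definition qform (Q : 'M[R]_n) (v : 'rV[R]_n) : R :=
  \sum_i \sum_j Q i j * v 0 i * v 0 j.

Lemma qform_shift Q v i x : Q^T = Q ->
  qform Q (v + x *: delta_mx 0 i) =
  qform Q v + 2 * x * \sum_j Q i j * v 0 j + x ^+ 2 * Q i i.
Proof.
move=> symQ; have Qs a b : Q a b = Q b a by rewrite -{1}symQ mxE.
pose e (j : 'I_n) : R := (j == i)%:R.
have pick (F : 'I_n -> R) : \sum_j F j * e j = F i.
  rewrite (bigD1 i) //= /e eqxx mulr1 big1 ?addr0 // => j /negPf ->.
  by rewrite mulr0.
have -> : qform Q (v + x *: delta_mx 0 i) =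
  \sum_a \sum_b (Q a b * v 0 a * v 0 b)
   + x * \sum_a (\sum_b Q a b * v 0 b) * e a
   + x * (\sum_a \sum_b Q a b * v 0 a * e b)
   + x ^+ 2 * \sum_a (\sum_b Q a b * e b) * e a.
  rewrite !mulr_sumr -!big_split; apply: eq_bigr => a _ /=.
  rewrite !mulr_suml !mulr_sumr -!big_split; apply: eq_bigr => b _ /=.
  by rewrite !mxE /= -/(e a) -/(e b); ring.
rewrite !pick; congr (_ + _); rewrite -addrA; congr (_ + _).
have -> : \sum_a \sum_b Q a b * v 0 a * e b = \sum_j Q i j * v 0 j.
  by apply: eq_bigr => a _; rewrite pick Qs.
by ring.
Qed.

(** Cholesky elimination: subtracting from Q the square of its i-th row, divided
    by the pivot, keeps Q positive semidefinite and clears the row i. *)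
Lemma psd_sum_outer (Q : 'M[R]_n) : Q^T = Q -> (forall v, 0 <= qform Q v) ->
  exists s : seq 'rV[R]_n, forall i j, Q i j = \sum_(h <- s) h 0 i * h 0 j.
Proof.
move=> symQ psdQ.
(* At stage l the rows of index at least l have been cleared. *)
suff H l (P : 'M[R]_n) : P^T = P -> (forall v, 0 <= qform P v) ->
    (forall i j : 'I_n, (l <= i)%N -> P i j = 0) ->
    exists s : seq 'rV[R]_n, forall i j, P i j = \sum_(h <- s) h 0 i * h 0 j.
  by apply: (H n) => // i j; rewrite leqNgt ltn_ord.
elim: l P => [|l IH] P symP psdP rowP.
  by exists [::] => i j; rewrite big_nil rowP.
have [nl|ln] := leqP n l.
  apply: IH => // i j li; have := leq_trans nl li.
  by rewrite leqNgt ltn_ord.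
pose i := Ordinal ln; have Ps a b : P a b = P b a by rewrite -{1}symP mxE.
pose q (v : 'rV[R]_n) : R := \sum_j P i j * v 0 j.
have shift v x : 0 <= qform P v + 2 * x * q v + x ^+ 2 * P i i.
  by rewrite -qform_shift.
have qdelta j : q (delta_mx 0 j) = P i j.
  rewrite /q (bigD1 j) //= mxE !eqxx mulr1 big1 ?addr0 // => k kj.
  by rewrite mxE (negPf kj) mulr0.
have Pii0 : 0 <= P i i.
  have q0 : q 0 = 0 by rewrite /q big1 // => j _; rewrite mxE mulr0.
  have Q0 : qform P 0 = 0.
    by rewrite /qform big1 // => a _; rewrite big1 // => b _; rewrite !mxE mulr0.
  by have := shift 0 1; rewrite q0 Q0 mulr0 !add0r expr1n mul1r.
have [Pii|Pii] := eqVneq (P i i) 0.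
  apply: IH => // a b; rewrite leq_eqVlt => /orP[/eqP la|]; last exact: rowP.
  have {a la}-> : a = i by apply: val_inj.
  (* A zero pivot forces a zero row: the form is affine in x along the i-th
     axis, with slope 2 q(v). *)
  rewrite -qdelta; set v := delta_mx 0 b; apply/eqP/negP => /negP qv0.
  have := shift v (- (qform P v + 1) / (2 * q v)).
  rewrite Pii mulr0 addr0 leNgt => /negP; apply.
  have -> : 2 * (- (qform P v + 1) / (2 * q v)) * q v = - (qform P v + 1) by field.
  by rewrite opprD addrA subrr sub0r ltrN10.
have Pp : 0 < P i i by rewrite lt_neqAle eq_sym Pii.
pose P' : 'M[R]_n := \matrix_(a, b) (P a b - P i a * P i b / P i i).
case: (IH P').
- by apply/matrixP => a b; rewrite !mxE (Ps a b) [P i b * _]mulrC.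
- move=> v; have -> : qform P' v = qform P v - q v ^+ 2 / P i i.
    rewrite expr2 {1}/q mulr_suml mulr_suml /qform -sumrB; apply: eq_bigr => a _.
    rewrite /q mulr_sumr mulr_suml -sumrB; apply: eq_bigr => b _.
    by rewrite mxE; ring.
  (* The minimum of the form along the i-th axis through v. *)
  have := shift v (- q v / P i i); congr (0 <= _).
  by field.
- move=> a b; rewrite leq_eqVlt mxE => /orP[/eqP la|la].
    have {a la}-> : a = i by apply: val_inj.
    by rewrite mulrC mulKf // subrr.
  by rewrite (Ps i a) (rowP a b la) (rowP a i la) !mul0r subr0.
move=> s hs; exists ((Num.sqrt (P i i))^-1 *: row i P :: s) => a b.
rewrite big_cons -hs !mxE.
have := sqr_sqrtr Pii0; have : Num.sqrt (P i i) != 0 by rewrite gt_eqF // sqrtr_gt0.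
move: (Num.sqrt _) => w w0 <-; by field.
Qed.

End Cholesky.

(** * Matrix polynomials that are positive definite on a box *)

Section BoxCertificate.
Variables (R : realType) (n : nat).

Definition in_box (c : R) (x : 'rV[R]_n) : Prop := forall i, -c <= x 0 i <= c.

(** The affine coordinate that maps [-c, c] onto [0, 1]. *)
Definition boxvar (c : R) (i : 'I_n) : {mpoly R[n]} :=
  (2 * c)^-1 *: (c%:MP + 'X_i).

Lemma evalp_boxvar c i (x : 'rV[R]_n) :
  evalp (boxvar c i) x = (2 * c)^-1 * (c + x 0 i).
Proof. by rewrite /boxvar -mul_mpolyC evalpM evalpC evalpD evalpC evalpXU. Qed.

Lemma boxvar_bounds c x i : 0 < c -> in_box c x -> 0 <= evalp (boxvar c i) x <= 1.
Proof.
move=> c0 /(_ i) /andP[h1 h2]; rewrite evalp_boxvar.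
have c2 : 0 < 2 * c by rewrite mulr_gt0.
rewrite mulrC divr_ge0 ?(ltW c2) //=; last by lra.
by rewrite ler_pdivrMr // mul1r; lra.
Qed.

Lemma polyX_boxvar c i : 0 < c ->
  'X_i = (- c)%:MP + (2 * c)%:MP * boxvar c i :> {mpoly R[n]}.
Proof.
move=> c0; rewrite /boxvar mul_mpolyC scalerA divff ?scale1r; last first.
  by rewrite mulf_neq0 ?pnatr_eq0 // gt_eqF.
by rewrite mpolyCN addKr.
Qed.

Lemma tbounded_box c p : 0 < c ->
  exists C d, 0 <= C /\ tbounded (boxvar c) C d p.
Proof.
move=> c0; elim/mpoly_ring_ind: p => [a|i|p q|p q].
- by exists `|a|, 0; split=> //; apply: tboundedC.
- rewrite (polyX_boxvar i c0).
  exists (`|-c| + `|2 * c| * 1), (0 + (0 + 1))%N; split.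
    by rewrite addr_ge0 // mulr_ge0.
  apply: tboundedD; first exact: tboundedC.
  by apply: tboundedM => //; [exact: tboundedC | exact: tbounded_gen].
- move=> [C [d [C0 b]]] [C' [d' [C'0 b']]]; exists (C + C'), (d + d')%N.
  by split; [exact: addr_ge0 | exact: tboundedD].
- move=> [C [d [C0 b]]] [C' [d' [C'0 b']]]; exists (C * C'), (d + d')%N.
  by split; [exact: mulr_ge0 | exact: tboundedM].
Qed.

(** A Bernstein polynomial is a product of factors proportional to c + X_i and
    c - X_i. *)
Lemma bernM_preorder1 (M c : R) k (nu : {ffun 'I_n -> 'I_k.+1}) :
  0 < c -> M <= c ^+ 2 ->
  preorder1 (mpolyC n M - \sum_(i < n) 'X_i ^+ 2) (bernM nu (boxvar c)).
Proof.
move=> c0 Mc; set rho := (X in preorder1 X _).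
have b0 (b : bool) (i : 'I_n) :
    preorder1 rho ((2 * c)^-1 *: (c%:MP + (-1) ^+ b *: 'X_i)).
  apply: preorder1Z; last exact: preorder1_box.
  by rewrite invr_ge0 mulr_ge0 // ltW.
have Tt i : preorder1 rho (boxvar c i).
  by have := b0 false i; rewrite expr0 scale1r.
have Tt' i : preorder1 rho (1 - boxvar c i).
  suff -> : 1 - boxvar c i = (2 * c)^-1 *: (c%:MP + (-1) ^+ true *: 'X_i) by [].
  rewrite {1}(_ : 1 = (2 * c)^-1 *: (2 * c)%:MP) /boxvar; last first.
    by rewrite -mul_mpolyC -mpolyCM mulVf // mulf_neq0 ?pnatr_eq0 // gt_eqF.
  rewrite -scalerBr expr1 scaleN1r; congr (_ *: _).
  by rewrite mpolyCM mpolyCMn mpolyC1; ring.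
rewrite /bernM; apply: (big_ind (preorder1 rho)) => [||i _].
- by apply: preorder1_sos; apply: sos1.
- by move=> x y; apply: preorder1M.
- by apply: preorder1Z => //; apply: preorder1M; apply: preorder1X.
Qed.

(** Entries of size at most e / (n + 1) make a form of size at most e |v|^2, as
    |v_i v_j| <= (v_i^2 + v_j^2) / 2. *)
Lemma psd_perturb (Q P : 'M[R]_n) (e : R) (v : 'rV[R]_n) : 0 < e ->
  (forall i j, `|Q i j - P i j| <= e / n.+1%:R) ->
  e * (\sum_i v 0 i ^+ 2) <= qform P v -> 0 <= qform Q v.
Proof.
move=> e0 QP hP.
have : `|qform Q v - qform P v| <= e * (\sum_i v 0 i ^+ 2).
  rewrite /qform -sumrB; apply: le_trans (ler_norm_sum _ _ _) _.
  apply: le_trans (_ : \sum_i \sum_j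
      (e / n.+1%:R) * ((v 0 i ^+ 2 + v 0 j ^+ 2) / 2) <= _).
    apply: ler_sum => i _; rewrite -sumrB; apply: le_trans (ler_norm_sum _ _ _) _.
    apply: ler_sum => j _; rewrite -2![_ * v 0 i * _]mulrA -mulrBl normrM.
    apply: ler_pM => //; rewrite ler_norml; apply/andP; split.
      by have := sqr_ge0 (v 0 i + v 0 j); lra.
    by have := sqr_ge0 (v 0 i - v 0 j); lra.
  under eq_bigr => i _ do rewrite -mulr_sumr -mulr_suml big_split /= sumr_const card_ord.
  rewrite -mulr_sumr -mulr_suml big_split /= sumr_const card_ord sumrMnl.
  set S := \sum_i _; rewrite -[S *+ n]mulr_natl.
  have S0 : 0 <= S by apply: sumr_ge0 => i _; apply: sqr_ge0.
  have -> : e / n.+1%:R * ((n%:R * S + n%:R * S) / 2) = e * S * (n%:R / n.+1%:R).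
    have : n.+1%:R != 0 :> R by rewrite pnatr_eq0.
    by move: (n.+1%:R : R) (n%:R : R) => a a' a0; field.
  apply: ler_piMr; first by rewrite mulr_ge0 // ltW.
  by rewrite ler_pdivrMr // mul1r ler_nat.
by rewrite ler_norml => /andP[h _]; lra.
Qed.

(** The Bernstein coefficients of P are close to the values of P on the grid,
    which are at least e I; hence they are positive semidefinite, and sums of
    outer products. The grid size k depends on P only through the bounds C, d
    and e. *)
Lemma psd_box_certificate (c C e : R) (d : nat) : 0 < c -> 0 <= C -> 0 < e ->
  exists k : nat, forall P : 'M[{mpoly R[n]}]_n,
    P^T = P -> (forall i j, tbounded (boxvar c) C d (P i j)) ->
    (forall x (v : 'rV[R]_n), in_box c x ->
       e * (\sum_i v 0 i ^+ 2) <= qform (evalmx P x) v) ->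
  exists s : {ffun 'I_n -> 'I_k.+1} -> seq 'rV[R]_n, forall i j,
    P i j = \sum_nu (\sum_(h <- s nu) h 0 i * h 0 j) *: bernM nu (boxvar c).
Proof.
move=> c0 C0 e0; have e'0 : 0 < e / n.+1%:R by rewrite divr_gt0.
have [k [k0 hk]] := tbounded_bern (boxvar c) d C0 e'0.
exists k => P symP bP posP.
have Ps i j : P i j = P j i by rewrite -{1}symP mxE.
pose b i j := sval (cid (hk _ (bP i j))).
have bE i j : P i j = \sum_nu b i j nu *: bernM nu (boxvar c).
  by have [] := svalP (cid (hk _ (bP i j))).
have bN i j (nu : {ffun 'I_n -> 'I_k.+1}) (x : 'rV[R]_n) :
    (forall l, evalp (boxvar c l) x = (nu l : nat)%:R / k%:R) ->
    `|b i j nu - evalp (P i j) x| <= e / n.+1%:R.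
  by have [_] := svalP (cid (hk _ (bP i j))); apply.
(* The expansions of P i j and P j i were chosen independently; keeping the
   upper triangle makes the coefficient matrix symmetric. *)
pose Q (nu : {ffun 'I_n -> 'I_k.+1}) : 'M[R]_n :=
  \matrix_(i, j) if (i <= j)%N then b i j nu else b j i nu.
have symQ nu : (Q nu)^T = Q nu.
  apply/matrixP => i j; rewrite !mxE.
  by case: ltngtP => // /val_inj ->.
have psdQ nu v : 0 <= qform (Q nu) v.
  pose x : 'rV[R]_n := \row_l (c * (2 * ((nu l : nat)%:R / k%:R) - 1)).
  have kR : 0 < k%:R :> R by rewrite ltr0n.
  have hx l : evalp (boxvar c l) x = (nu l : nat)%:R / k%:R.
    by rewrite evalp_boxvar mxE; field; rewrite !gt_eqF.
  have xb : in_box c x.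
    move=> l; rewrite mxE.
    have : 0 <= (nu l : nat)%:R / k%:R :> R by rewrite divr_ge0.
    have : (nu l : nat)%:R / k%:R <= 1 :> R.
      by rewrite ler_pdivrMr // mul1r ler_nat -ltnS.
    move: (_ / _) => w w1 w0.
    have cw : 0 <= c * w by rewrite mulr_ge0 // ltW.
    have cw' : 0 <= c * (1 - w) by rewrite mulr_ge0 ?subr_ge0 // ltW.
    by apply/andP; split; lra.
  apply: (psd_perturb e0 _ (posP x v xb)) => i j; rewrite !mxE.
  by case: ifP => _; [|rewrite Ps]; apply: bN.
pose s nu := sval (cid (psd_sum_outer (symQ nu) (psdQ nu))).
exists s => i j.
wlog ij : i j / (i <= j)%N => [H|].
  have [|/ltnW] := leqP i j; first exact: H.
  rewrite Ps => /H ->; apply: eq_bigr => nu _; congr (_ *: _).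
  by apply: eq_bigr => h _; rewrite mulrC.
rewrite bE; apply: eq_bigr => nu _; congr (_ *: _).
by rewrite -(svalP (cid (psd_sum_outer (symQ nu) (psdQ nu)))) mxE ij.
Qed.

End BoxCertificate.

(** * Compactness of boxes *)

Section BoxCompactness.
Variables (R : realType) (I : finType).
Implicit Types F H : (I -> R) -> R.

(** Continuity on the space of functions from I to R, carried by row vectors,
    where compactness of boxes is available. *)
Definition cts F : Prop :=
  continuous (fun z : 'rV[R]_#|I| => F (fun k => z 0 (enum_rank k))).

Lemma cts_cst a : cts (fun _ => a).
Proof. exact: cst_continuous. Qed.

Lemma eq_cts F H : (forall a, F a = H a) -> cts F -> cts H.
Proof. by move=> FH; rewrite (_ : F = H) //; apply/funext. Qed.

Lemma cts_coord k : cts (fun a => a k).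
Proof. exact: (@coord_continuous R 1 #|I| 0 (enum_rank k)). Qed.

Lemma ctsD F H : cts F -> cts H -> cts (fun a => F a + H a).
Proof. by move=> cF cH z; exact: (cvgD (cF z) (cH z)). Qed.

Lemma ctsM F H : cts F -> cts H -> cts (fun a => F a * H a).
Proof. by move=> cF cH z; exact: (cvgM (cF z) (cH z)). Qed.

Lemma ctsN F : cts F -> cts (fun a => - F a).
Proof. by move=> cF z; exact: (cvgN (cF z)). Qed.

Lemma cts_norm F : cts F -> cts (fun a => `|F a|).
Proof. by move=> cF z; exact: (cvg_norm (cF z)). Qed.

Lemma cts_sum (J : finType) (F : J -> (I -> R) -> R) :
  (forall j, cts (F j)) -> cts (fun a => \sum_j F j a).
Proof.
move=> cF; have : cts (fun a => \sum_(j <- index_enum J) F j a).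
  elim: (index_enum J) => [|j s IH].
    rewrite (_ : (fun _ => _) = fun=> 0); first exact: cts_cst.
    by apply/funext => a; rewrite big_nil.
  rewrite (_ : (fun _ => _) = fun a => F j a + \sum_(i <- s) F i a).
    exact: ctsD.
  by apply/funext => a; rewrite big_cons.
by [].
Qed.

Lemma cts_evalp n (x : (I -> R) -> 'rV[R]_n) (p : {mpoly R[n]}) :
  (forall i, cts (fun a => x a 0 i)) -> cts (fun a => evalp p (x a)).
Proof.
move=> cx; elim/mpoly_ring_ind: p => [c|i|p q cp cq|p q cp cq].
- rewrite (_ : (fun _ => _) = fun=> c); first exact: cts_cst.
  by apply/funext => a; rewrite evalpC.
- by rewrite (_ : (fun _ => _) = fun a => x a 0 i) //; apply/funext => a;
    rewrite evalpXU.
- rewrite (_ : (fun _ => _) = fun a => evalp p (x a) + evalp q (x a)); first exact: ctsD.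
  by apply/funext => a; rewrite evalpD.
- rewrite (_ : (fun _ => _) = fun a => evalp p (x a) * evalp q (x a)); first exact: ctsM.
  by apply/funext => a; rewrite evalpM.
Qed.

Lemma cts_box_min c F : 0 <= c -> cts F ->
  exists2 a, (forall k, -c <= a k <= c) &
    forall b, (forall k, -c <= b k <= c) -> F a <= F b.
Proof.
move=> c0 cF.
pose A : set 'rV[R]_#|I| := [set v | forall i, `[-c, c]%classic (v ord0 i)].
have cA : compact A.
  apply: (@rV_compact R #|I| (fun=> `[-c, c]%classic)) => i.
  exact: segment_compact.
have A0 : A !=set0.
  by exists 0 => i; rewrite /= mxE in_itv /= oppr_le0 c0.
have [z zA zmin] := compact_EVT_min A0 cA (continuous_subspaceT cF).
exists (fun k => z 0 (enum_rank k)).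
  by move=> k; move: zA; rewrite inE => /(_ (enum_rank k)); rewrite /= in_itv.
move=> b hb.
have -> : b = fun k => (\row_l b (enum_val l)) 0 (enum_rank k).
  by apply/funext => k; rewrite mxE enum_rankK.
by apply: zmin; rewrite inE => i; rewrite /= mxE in_itv /=.
Qed.

(** The function F^+ + sum_j H_j^- is positive on the box, so it has a positive
    minimum there, and one of its terms must be large. *)
Lemma box_dichotomy (J : finType) c F (H : J -> (I -> R) -> R) :
  0 <= c -> cts F -> (forall j, cts (H j)) ->
  (forall a, (forall k, -c <= a k <= c) -> (forall j, 0 <= H j a) -> 0 < F a) ->
  exists eta B, [/\ 0 < eta, 0 <= B & forall a, (forall k, -c <= a k <= c) ->
     -B <= F a /\ (eta <= F a \/ exists j, H j a <= - eta)].
Proof.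
move=> c0 cF cH pos.
pose K a := (`|F a| + F a) + \sum_j (`|H j a| + - H j a).
have cK : cts K.
  apply: ctsD; first by apply: ctsD => //; apply: cts_norm.
  by apply: cts_sum => j; apply: ctsD; [apply: cts_norm|apply: ctsN].
have [a ha amin] := cts_box_min c0 cK.
have [b hb bmin] := cts_box_min c0 cF.
have nF x : 0 <= `|x| + x :> R by rewrite -[X in _ + X]opprK subr_ge0 -normrN ler_norm.
have nH x : 0 <= `|x| + - x :> R by rewrite subr_ge0 ler_norm.
have Ka : 0 < K a.
  have S0 : 0 <= \sum_j (`|H j a| + - H j a) by apply: sumr_ge0.
  have [/forallP h|] := boolP [forall j, 0 <= H j a].
    have F0 := pos a ha h.
    by rewrite /K; have := nF (F a); have := ler_norm (F a); lra.
  rewrite negb_forall => /existsP[j]; rewrite -ltNge => Hj.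
  suff : 0 < \sum_j (`|H j a| + - H j a) by have := nF (F a); rewrite /K; lra.
  rewrite (bigD1 j) //= ltr_pwDl ?sumr_ge0 // ltr0_norm //; lra.
pose m : R := #|J|.+1%:R; have m0 : 0 < m by rewrite ltr0n.
pose eta := K a / (2 * m).
have eta0 : 0 < eta by rewrite divr_gt0 // mulr_gt0.
exists eta, `|F b|; split=> // x hx; split.
  by apply: le_trans (bmin _ hx); rewrite lerNl -normrN ler_norm.
have [|Feta] := leP eta (F x); [by left|right].
have [/forallP h|] := boolP [forall j, - eta < H j x]; last first.
  by rewrite negb_forall => /existsP[j]; rewrite -leNgt => Hj; exists j.
exfalso; have : K x < 2 * eta * m.
  have F1 : `|F x| + F x < 2 * eta by case: (ger0P (F x)) => ?; lra.
  have : \sum_j (`|H j x| + - H j x) <= \sum_(j : J) 2 * eta.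
    by apply: ler_sum => j _; have := h j; case: (ger0P (H j x)) => ??; lra.
  rewrite sumr_const -[leRHS]mulr_natl /K /m -natr1 => F2; lra.
have -> : 2 * eta * m = K a.
  by rewrite mulrAC mulrC /eta divfK // gt_eqF // mulr_gt0.
by rewrite ltNge amin.
Qed.

End BoxCompactness.

(** * Penalizing violated constraints *)
Section Penalty.
Variable R : realType.

Lemma bernoulli_decay (y : R) m : 0 <= y <= 1 -> m%:R * (y * (1 - y) ^+ m) <= 1.
Proof.
move=> /andP[y0 y1]; have p k : 0 <= (1 - y) ^+ k by rewrite exprn_ge0 // subr_ge0.
suff : (1 - y) ^+ m * (1 + m%:R * y) <= 1.
  by move=> h; have := p m; move: (_ ^+ m) h => z; nra.
elim: m => [|m IH]; first by rewrite expr0 mul0r addr0 mul1r.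
apply: le_trans IH; rewrite exprSr -mulrA ler_wpM2l // -natr1.
have : 0 <= (m%:R : R) by []; move: (m%:R : R) => z z0; nra.
Qed.

(** The term h (1 - h / gam)^(2p) is negligible for 0 <= h <= gam and p large, and
    it is at most h for h <= 0. So the penalty barely costs anything where the
    constraints hold, and where one of them fails by eta it outweighs B for lam
    large enough. *)
Lemma penalty (r : nat) (eta B gam : R) : 0 < eta -> 0 <= B -> 0 < gam ->
  exists (lam : R) (p : nat), 0 <= lam /\
    forall (F : R) (h : 'I_r -> R), -B <= F -> (forall k, `|h k| <= gam) ->
      eta <= F \/ (exists k, h k <= - eta) ->
      eta / 2 <= F - lam * \sum_k h k * ((1 - h k / gam) ^+ p) ^+ 2.
Proof.
move=> eta0 B0 gam0; pose lam := (B + eta) / eta.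
have lam0 : 0 <= lam by rewrite divr_ge0 ?addr_ge0 // ltW.
have lamE : lam * eta = B + eta by rewrite /lam divfK // gt_eqF.
(* N is such that lam r gam / N <= eta / 2. *)
pose N := (Num.truncn (2 * lam * r%:R * gam / eta)).+1.
exists lam, N; split=> // F h FB hg alt.
have N0 : 0 < (N%:R : R) by rewrite ltr0n.
pose del := gam / N%:R.
have del0 : 0 < del by rewrite divr_gt0.
have small : lam * (r%:R * del) <= eta / 2.
  have := truncnS_gt (2 * lam * r%:R * gam / eta); rewrite -/N ltr_pdivrMr // => hN.
  by rewrite /del !mulrA ler_pdivrMr //; lra.
pose T k := h k * ((1 - h k / gam) ^+ N) ^+ 2.
have Tle k : T k <= del.
  have [hk|hk] := leP 0 (h k); last first.
    rewrite (le_trans _ (ltW del0)) // /T mulr_le0_ge0 ?sqr_ge0 // ltW //.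
  have /andP[y0 y1] : 0 <= h k / gam <= 1.
    by rewrite divr_ge0 ?(ltW gam0) //= ler_pdivrMr // mul1r (le_trans (ler_norm _)).
  have := @bernoulli_decay (h k / gam) N; rewrite y0 y1 => /(_ isT).
  have z0 : 0 <= (1 - h k / gam) ^+ N by rewrite exprn_ge0 // subr_ge0.
  have z1 : (1 - h k / gam) ^+ N <= 1 by rewrite exprn_ile1 // ?subr_ge0 // gerBl.
  move=> dec; rewrite /T /del ler_pdivlMr //.
  have := ler_wpM2l (ltW gam0) dec.
  rewrite (_ : gam * _ = h k * (1 - h k / gam) ^+ N * N%:R); last first.
    by move: (_ ^+ _) => z; field; rewrite gt_eqF.
  rewrite mulr1; apply: le_trans; rewrite ler_pM2r // ler_wpM2l // expr2.
  by rewrite ler_piMr.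
have sumT (P : pred 'I_r) : \sum_(k | P k) T k <= r%:R * del.
  apply: le_trans (_ : \sum_(k < r) del <= _); last first.
    by rewrite sumr_const card_ord -[leLHS]mulr_natl.
  rewrite big_mkcond; apply: ler_sum => k _; case: ifP => _ //.
  exact: ltW.
case: alt => [etaF|[k hk]].
  have := ler_wpM2l lam0 (sumT xpredT); rewrite -/(T _).
  move=> h1; have := le_trans h1 small; rewrite /T; lra.
have : \sum_k T k <= - eta + r%:R * del.
  rewrite (bigD1 k) //=; apply: lerD => //.
  have hk0 : h k < 0 by rewrite (le_lt_trans hk) // oppr_lt0.
  apply: le_trans hk; rewrite /T -[leRHS]mulr1 ler_nM2l // -exprM exprn_ege1 //.
  by rewrite lerDl oppr_ge0 mulr_le0_ge0 ?invr_ge0 ?(ltW gam0) // ltW.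
move/(ler_wpM2l lam0); rewrite mulrDr mulrN lamE /T; lra.
Qed.

End Penalty.

(** * Families of polynomials along segments *)

Section UniformBounds.
Variables (R : realType) (n : nat) (c : R) (c0 : 0 < c).
Implicit Types p q : {mpoly R[n]}.

(** A family of polynomials, indexed by the parameters in Th, with common
    bounds on the coefficients and the degree in the box coordinates. *)
Definition ubounded (T : Type) (Th : T -> Prop) (F : T -> {mpoly R[n]}) : Prop :=
  exists C d, 0 <= C /\ forall a, Th a -> tbounded (boxvar c) C d (F a).

Variables (T : Type) (Th : T -> Prop).
Implicit Types F H : T -> {mpoly R[n]}.

Lemma uboundedD F H : ubounded Th F -> ubounded Th H ->
  ubounded Th (fun a => F a + H a).
Proof.
move=> [C [d [C0 b]]] [C' [d' [C'0 b']]]; exists (C + C'), (d + d')%N.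
split; first exact: addr_ge0.
by move=> a ha; apply: tboundedD; [apply: b | apply: b'].
Qed.

Lemma uboundedM F H : ubounded Th F -> ubounded Th H ->
  ubounded Th (fun a => F a * H a).
Proof.
move=> [C [d [C0 b]]] [C' [d' [C'0 b']]]; exists (C * C'), (d + d')%N.
split; first exact: mulr_ge0.
by move=> a ha; apply: tboundedM => //; [apply: b | apply: b'].
Qed.

Lemma uboundedC (f : T -> R) C : 0 <= C -> (forall a, Th a -> `|f a| <= C) ->
  ubounded Th (fun a => (f a)%:MP).
Proof.
by move=> C0 fC; exists C, 0%N; split=> // a ha; apply: tboundedC; apply: fC.
Qed.

Lemma ubounded_cst p : ubounded Th (fun=> p).
Proof. by have [C [d [C0 b]]] := tbounded_box p c0; exists C, d. Qed.

Lemma uboundedN F : ubounded Th F -> ubounded Th (fun a => - F a).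
Proof.
move=> bF; rewrite (_ : (fun _ => _) = fun a => (-1)%:MP * F a); last first.
  by apply/funext => a; rewrite mpolyCN mulNr mul1r.
by apply: uboundedM => //; apply: ubounded_cst.
Qed.

Lemma ubounded_sum (J : finType) (F : J -> T -> {mpoly R[n]}) :
  (forall j, ubounded Th (F j)) -> ubounded Th (fun a => \sum_j F j a).
Proof.
move=> bF; have : ubounded Th (fun a => \sum_(j <- index_enum J) F j a).
  elim: (index_enum J) => [|j s IH].
    rewrite (_ : (fun _ => _) = fun=> 0); first exact: ubounded_cst.
    by apply/funext => a; rewrite big_nil.
  rewrite (_ : (fun _ => _) = fun a => F j a + \sum_(i <- s) F i a).
    exact: uboundedD.
  by apply/funext => a; rewrite big_cons.
by [].
Qed.

End UniformBounds.

Lemma tbounded_mono (R : realType) n (t : 'I_n -> {mpoly R[n]}) C d C' d' p :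
  C <= C' -> (d <= d')%N -> tbounded t C d p -> tbounded t C' d' p.
Proof.
move=> CC dd [s [-> sC sd]]; exists s; split=> //; first exact: le_trans CC.
by move=> am h i; apply: leq_trans dd; apply: sd.
Qed.

Lemma ubounded_fin (R : realType) n (c : R) (T : Type) (Th : T -> Prop)
    (J : finType) (F : J -> T -> {mpoly R[n]}) :
  (forall j, ubounded c Th (F j)) ->
  exists C d, 0 <= C /\ forall j a, Th a -> tbounded (boxvar c) C d (F j a).
Proof.
move=> bF; pose C j := sval (cid (bF j)).
have hC j : exists d, 0 <= C j /\
    forall a, Th a -> tbounded (boxvar c) (C j) d (F j a).
  exact: svalP (cid (bF j)).
pose d j := sval (cid (hC j)).
have hd j : 0 <= C j /\ forall a, Th a -> tbounded (boxvar c) (C j) (d j) (F j a).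
  exact: svalP (cid (hC j)).
exists (\sum_j C j), (\sum_j d j)%N; split.
  by apply: sumr_ge0 => j _; have [] := hd j.
move=> j a ha; have [_ h] := hd j; apply: tbounded_mono (h _ ha).
  by rewrite (bigD1 j) //= lerDl sumr_ge0 // => i _; have [] := hd i.
by rewrite (bigD1 j) //= leq_addr.
Qed.

Section Segment.
Variables (R : realType) (n : nat).
Implicit Types (p q : {mpoly R[n]}) (u x : 'rV[R]_n).

(** The polynomial p((1 - s) u + s X) in X. *)
Definition segpoly u (s : R) p : {mpoly R[n]} :=
  mmap (@mpolyC n R) (fun i => ((1 - s) * u 0 i)%:MP + s *: 'X_i) p.

Lemma segpolyD u s p q : segpoly u s (p + q) = segpoly u s p + segpoly u s q.
Proof. exact: mmapD. Qed.

Lemma segpolyM u s p q : segpoly u s (p * q) = segpoly u s p * segpoly u s q.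
Proof. exact: rmorphM. Qed.

Lemma segpolyC u s a : segpoly u s a%:MP = a%:MP.
Proof. exact: mmapC. Qed.

Lemma segpolyXU u s i :
  segpoly u s 'X_i = ((1 - s) * u 0 i)%:MP + s *: 'X_i.
Proof. by rewrite /segpoly mmapX mmap1U. Qed.

Lemma evalp_segpoly u s p x :
  evalp (segpoly u s p) x = evalp p ((1 - s) *: u + s *: x).
Proof.
elim/mpoly_ring_ind: p => [a|i|p q hp hq|p q hp hq].
- by rewrite segpolyC !evalpC.
- by rewrite segpolyXU evalpD evalpC -mul_mpolyC evalpM evalpC !evalpXU !mxE.
- by rewrite segpolyD !evalpD hp hq.
- by rewrite segpolyM !evalpM hp hq.
Qed.

Lemma segpoly_ubounded (c : R) (T : Type) (Th : T -> Prop) (u : T -> 'rV[R]_n)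
    (s : T -> R) p : 0 < c ->
  (forall a, Th a -> in_box c (u a)) -> (forall a, Th a -> 0 <= s a <= 1) ->
  ubounded c Th (fun a => segpoly (u a) (s a) p).
Proof.
move=> c0 hu hs; elim/mpoly_ring_ind: p => [a|i|p q hp hq|p q hp hq].
- rewrite (_ : (fun _ => _) = fun=> a%:MP); first exact: ubounded_cst.
  by apply/funext => b; rewrite segpolyC.
- rewrite (_ : (fun _ => _) =
    fun a => ((1 - s a) * u a 0 i)%:MP + (s a)%:MP * 'X_i); last first.
    by apply/funext => a; rewrite segpolyXU mul_mpolyC.
  apply: uboundedD.
    apply: (@uboundedC _ _ _ _ _ _ c); first exact: ltW.
    move=> a ha; have /andP[s0 s1] := hs a ha.
    rewrite normrM ger0_norm ?subr_ge0 // -[leRHS]mul1r ler_pM ?subr_ge0 //.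
      by rewrite gerBl.
    by rewrite ler_norml; apply: hu.
  apply: uboundedM; last exact: ubounded_cst.
  by apply: (@uboundedC _ _ _ _ _ _ 1) => // a /hs /andP[s0 s1]; rewrite ger0_norm.
- rewrite (_ : (fun _ => _) = fun a => segpoly (u a) (s a) p + segpoly (u a) (s a) q).
    exact: uboundedD.
  by apply/funext => a; rewrite segpolyD.
- rewrite (_ : (fun _ => _) = fun a => segpoly (u a) (s a) p * segpoly (u a) (s a) q).
    exact: uboundedM.
  by apply/funext => a; rewrite segpolyM.
Qed.

End Segment.

Section HessianFamily.
Variables (R : realType) (n m : nat) (G : 'M[{mpoly R[n]}]_m).

Lemma quadformE (xi : 'cV[R]_m) :
  quadform G xi = \sum_a \sum_b (xi a 0 * xi b 0)%:MP * G a b.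
Proof.
rewrite /quadform mxE exchange_big /=.
apply: eq_bigr => b _.
rewrite mxE mulr_suml; apply: eq_bigr => a _.
by rewrite !mxE mpolyCM; ring.
Qed.

Definition hessp (xi : 'cV[R]_m) (i j : 'I_n) : {mpoly R[n]} :=
  mderiv j (mderiv i (quadform G xi)).

Lemma hesspE xi i j : hessp xi i j =
  \sum_a \sum_b (xi a 0 * xi b 0)%:MP * mderiv j (mderiv i (G a b)).
Proof.
have dS l (F : 'I_m -> {mpoly R[n]}) :
    mderiv l (\sum_a F a) = \sum_a mderiv l (F a).
  exact: (raddf_sum (mderiv l)).
rewrite /hessp quadformE !dS; apply: eq_bigr => a _ /=.
rewrite !dS; apply: eq_bigr => b _.
by rewrite !mderiv_mulC.
Qed.

Lemma hessp_sym xi i j : hessp xi i j = hessp xi j i.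
Proof. by rewrite /hessp mderiv_comm. Qed.

Lemma evalp_sum (I : Type) (s : seq I) (F : I -> {mpoly R[n]}) x :
  evalp (\sum_(i <- s) F i) x = \sum_(i <- s) evalp (F i) x.
Proof. by rewrite /evalp raddf_sum. Qed.

End HessianFamily.

(** * Positive curvature on a box around the domain *)

Lemma convex_seg (R : realType) n (D : set 'rV[R]_n) u x s :
  convex_set (D : set (convex_lmodType 'rV[R]_n)) ->
  D u -> D x -> 0 <= s <= 1 -> D ((1 - s) *: u + s *: x).
Proof.
move=> cD Du Dx /andP[s0 s1].
have := cD x u (interval_inference.Itv01 s0 s1).
by rewrite !inE => /(_ Dx Du); rewrite addrC.
Qed.

Section Curvature.
Variables (R : realType) (n m r : nat).
Variables (G : 'M[{mpoly R[n]}]_m) (g : 'I_r -> {mpoly R[n]}).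

(** The second derivative of - xi^T G xi at z in the direction v. *)
Definition curv (xi : 'cV[R]_m) (z v : 'rV[R]_n) : R :=
  - \sum_i \sum_j evalp (hessp G xi i j) z * v 0 i * v 0 j.

Definition curvmx (q : {mpoly R[n]}) u s (xi : 'cV[R]_m) : 'M[{mpoly R[n]}]_n :=
  \matrix_(i, j) (- segpoly u s (hessp G xi i j) - q *+ (i == j)).

Lemma curvmx_sym q u s xi : (curvmx q u s xi)^T = curvmx q u s xi.
Proof. by apply/matrixP => i j; rewrite !mxE hessp_sym eq_sym. Qed.

Lemma qform_curvmx q u s xi x v :
  qform (evalmx (curvmx q u s xi) x) v =
  curv xi ((1 - s) *: u + s *: x) v - evalp q x * \sum_i v 0 i ^+ 2.
Proof.
have -> : \sum_i v 0 i ^+ 2 = \sum_i \sum_j (i == j)%:R * v 0 i * v 0 j.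
  apply: eq_bigr => i _; rewrite (bigD1 i) //= eqxx big1 => [|j].
    by rewrite mul1r addr0 expr2.
  by rewrite eq_sym => /negPf ->; rewrite !mul0r.
rewrite /qform /curv mulr_sumr -sumrN -sumrB; apply: eq_bigr => i _.
rewrite mulr_sumr -sumrN -sumrB; apply: eq_bigr => j _.
rewrite !mxE -evalp_segpoly /evalp mevalB mevalN.
by case: (i == j); rewrite ?mulr1n ?mulr0n ?meval0; ring.
Qed.

Lemma curv_gt0 xi z v : strictly_matrix_concave G (domD g) ->
  xi != 0 -> domD g z -> v != 0 -> 0 < curv xi z v.
Proof.
move=> conc xi0 Dz v0; have [_ /(_ v^T)] := conc xi xi0 z Dz.
rewrite trmxK -(inj_eq trmx_inj) trmxK trmx0 => /(_ v0); congr (0 < _).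
rewrite mxE /curv; under eq_bigr do rewrite mxE mulr_suml.
rewrite exchange_big -sumrN; apply: eq_bigr => i _ /=.
rewrite -sumrN; apply: eq_bigr => j _.
by rewrite !mxE /hessp; ring.
Qed.

Lemma curvE xi z v : curv xi z v =
  - \sum_i \sum_j (\sum_a \sum_b xi a 0 * xi b 0 *
      evalp (mderiv j (mderiv i (G a b))) z) * v 0 i * v 0 j.
Proof.
congr (- _); apply: eq_bigr => i _; apply: eq_bigr => j _; congr (_ * _ * _).
rewrite hesspE evalp_sum; apply: eq_bigr => a _; rewrite evalp_sum.
by apply: eq_bigr => b _; rewrite evalpM evalpC.
Qed.

Lemma curvZ xi z t v : curv xi z (t *: v) = t ^+ 2 * curv xi z v.
Proof.
rewrite /curv mulrN mulr_sumr; congr (- _); apply: eq_bigr => i _.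
by rewrite mulr_sumr; apply: eq_bigr => j _; rewrite !mxE; ring.
Qed.

Lemma sqsum_le1 (T : finType) (f : T -> R) i : \sum_j f j ^+ 2 = 1 -> -1 <= f i <= 1.
Proof.
move=> S1; have : f i ^+ 2 <= 1.
  by rewrite -S1 (bigD1 i) //= lerDl sumr_ge0 // => j _; apply: sqr_ge0.
by move=> h; apply/andP; split; nra.
Qed.

Section Dichotomy.
Variable c : R.
Hypotheses (c1 : 1 <= c) (Dbox : forall x, domD g x -> in_box c x).
Hypothesis D_convex : convex_set (domD g : set (convex_lmodType 'rV[R]_n)).
Hypothesis G_concave : strictly_matrix_concave G (domD g).

(** The parameters u, s, xi, x, v live in a common box. The conditions on them,
    spheres included, are written as inequalities H_j >= 0 among continuous
    functions, and under these the curvature is positive because u, x and the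
    points between them are in the convex domain. The only constraints that can
    fail when x leaves the domain are the g_k(x) >= 0. *)
Lemma curvature_dichotomy : exists eta B, [/\ 0 < eta, 0 <= B &
  forall u s (xi : 'cV[R]_m) (x v : 'rV[R]_n), domD g u -> 0 <= s <= 1 ->
    \sum_a xi a 0 ^+ 2 = 1 -> in_box c x -> \sum_i v 0 i ^+ 2 = 1 ->
    let F := curv xi ((1 - s) *: u + s *: x) v in
    -B <= F /\ (eta <= F \/ exists k, evalp (g k) x <= - eta)].
Proof.
pose I := ('I_n + unit + 'I_m + 'I_n + 'I_n)%type.
pose J := ('I_r + 'I_r + bool + bool + bool)%type.
pose cu (i : 'I_n) : I := inl (inl (inl (inl i))).
pose cs : I := inl (inl (inl (inr tt))).
pose cxi (i : 'I_m) : I := inl (inl (inr i)).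
pose cx (i : 'I_n) : I := inl (inr i).
pose cv (i : 'I_n) : I := inr i.
pose U (a : I -> R) : 'rV[R]_n := \row_i a (cu i).
pose X (a : I -> R) : 'rV[R]_n := \row_i a (cx i).
pose V (a : I -> R) : 'rV[R]_n := \row_i a (cv i).
pose Xi (a : I -> R) : 'cV[R]_m := \col_i a (cxi i).
pose Z (a : I -> R) : 'rV[R]_n := (1 - a cs) *: U a + a cs *: X a.
pose F (a : I -> R) := curv (Xi a) (Z a) (V a).
pose H (j : J) (a : I -> R) : R := match j with
  | inl (inl (inl (inl k))) => evalp (g k) (U a)
  | inl (inl (inl (inr k))) => evalp (g k) (X a)
  | inl (inl (inr b)) => b%:R + (-1) ^+ b * a cs
  | inl (inr b) => (-1) ^+ b * (\sum_i a (cxi i) ^+ 2 - 1)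
  | inr b => (-1) ^+ b * (\sum_i a (cv i) ^+ 2 - 1)
  end.
have ctsU i : cts (fun a => U a 0 i).
  by refine (eq_cts _ (@cts_coord R _ (cu i))) => a; rewrite mxE.
have ctsX i : cts (fun a => X a 0 i).
  by refine (eq_cts _ (@cts_coord R _ (cx i))) => a; rewrite mxE.
have ctsV i : cts (fun a => V a 0 i).
  by refine (eq_cts _ (@cts_coord R _ (cv i))) => a; rewrite mxE.
have ctsXi i : cts (fun a => Xi a i 0).
  by refine (eq_cts _ (@cts_coord R _ (cxi i))) => a; rewrite mxE.
have ctsZ i : cts (fun a => Z a 0 i).
  rewrite (_ : (fun _ => _) = fun a => (1 + - a cs) * U a 0 i + a cs * X a 0 i).
    apply: ctsD; apply: ctsM => //; last exact: cts_coord.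
    by apply: ctsD; [apply: cts_cst | apply: ctsN; apply: cts_coord].
  by apply/funext => a; rewrite mxE [(_ *: U a) 0 i]mxE [(_ *: X a) 0 i]mxE.
have ctsF : cts F.
  rewrite (_ : F = fun a => - \sum_i \sum_j (\sum_k \sum_l Xi a k 0 * Xi a l 0 *
      evalp (mderiv j (mderiv i (G k l))) (Z a)) * V a 0 i * V a 0 j); last first.
    by apply/funext => a; rewrite /F curvE.
  apply: ctsN; apply: cts_sum => i; apply: cts_sum => j.
  do 2 apply: ctsM => //.
  apply: cts_sum => k; apply: cts_sum => l; apply: ctsM; first exact: ctsM.
  exact: cts_evalp.
have ctsS (k : nat) (f : 'I_k -> I) (b : bool) :
    cts (fun a => (-1) ^+ b * (\sum_i a (f i) ^+ 2 - 1)).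
  apply: ctsM; first exact: cts_cst.
  apply: ctsD; last exact: cts_cst.
  by apply: cts_sum => i; apply: ctsM; apply: cts_coord.
have ctsH j : cts (H j).
  case: j => [[[[k|k]|b]|b]|b]; rewrite /H;
    [exact: cts_evalp | exact: cts_evalp | | exact: ctsS | exact: ctsS].
  by apply: ctsD; [exact: cts_cst | apply: ctsM; [exact: cts_cst|exact: cts_coord]].
have c0 : 0 <= c by apply: le_trans c1.
have sphere (w : R) :
    0 <= (-1) ^+ true * (w - 1) -> 0 <= (-1) ^+ false * (w - 1) -> w = 1.
  by rewrite expr1 expr0 => h1 h2; apply/le_anti/andP; split; lra.
have nz k l (v : 'M[R]_(k, l)) : \sum_i \sum_j v i j ^+ 2 = 1 -> v != 0.
  move=> S1; apply/eqP => v0; move: S1; rewrite v0 big1 => [|i _].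
    by move/eqP; rewrite eq_sym oner_eq0.
  by rewrite big1 // => j _; rewrite mxE expr0n.
have pos a : (forall k, -c <= a k <= c) -> (forall j, 0 <= H j a) -> 0 < F a.
  move=> _ Ha; apply: curv_gt0 => //.
  - apply: nz; under eq_bigr do rewrite big_ord1 mxE.
    by apply: sphere; [exact: (Ha (inl (inr true)))|exact: (Ha (inl (inr false)))].
  - apply: convex_seg => //.
    + by move=> k; exact: (Ha (inl (inl (inl (inl k))))).
    + by move=> k; exact: (Ha (inl (inl (inl (inr k))))).
    + have := Ha (inl (inl (inr true))); have := Ha (inl (inl (inr false))).
      by rewrite /H /= expr0 expr1 => h1 h2; apply/andP; split; lra.
  - apply: nz; rewrite big_ord1; under eq_bigr do rewrite mxE.
    by apply: sphere; [exact: (Ha (inr true))|exact: (Ha (inr false))].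
have [eta [B [eta0 B0 dich]]] := box_dichotomy c0 ctsF ctsH pos.
exists eta, B; split=> // u s xi x v Du s01 xi1 xbox v1 /=.
pose a (k : I) : R := match k with
  | inl (inl (inl (inl i))) => u 0 i
  | inl (inl (inl (inr _))) => s
  | inl (inl (inr i)) => xi i 0
  | inl (inr i) => x 0 i
  | inr i => v 0 i
  end.
have aU : U a = u by apply/rowP => i; rewrite mxE.
have aX : X a = x by apply/rowP => i; rewrite mxE.
have aV : V a = v by apply/rowP => i; rewrite mxE.
have aXi : Xi a = xi by apply/colP => i; rewrite mxE.
have unit_box y : -1 <= y <= 1 -> -c <= y <= c.
  move=> /andP[y0 y1]; have h := c1.
  by apply/andP; split; lra.
have abox k : -c <= a k <= c.
  case: k => [[[[i|[]]|i]|i]|i] /=.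
  - exact: Dbox.
  - by apply: unit_box; case/andP: s01 => s0 ->; rewrite (le_trans _ s0) // lerN10.
  - exact/unit_box/(sqsum_le1 (f := fun i => xi i 0)).
  - exact: xbox.
  - exact/unit_box/(sqsum_le1 (f := fun i => v 0 i)).
have := dich a abox; rewrite /F /Z aU aX aV aXi => -[FB alt]; split=> //.
case: alt => [|[j Hj]]; [by left | right].
have Hneg : ~ 0 <= H j a by rewrite leNgt (le_lt_trans Hj) // oppr_lt0.
case: j Hj Hneg => [[[[k|k]|b]|b]|b] /=.
- by rewrite aU => _ /(_ (Du k)).
- by rewrite aX => Hk _; exists k.
- case/andP: s01 => s0 s1; case: b => _ [] /=; rewrite ?expr0 ?expr1; lra.
- by rewrite xi1 subrr mulr0.
- by rewrite v1 subrr mulr0.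
Qed.

(** The defect of positivity outside the domain is absorbed by an element q of
    the quadratic module, the same for all parameters. *)
Lemma curvature_penalty : exists (q : {mpoly R[n]}) (e : R),
  [/\ quad_module g q, 0 < e &
  forall u s (xi : 'cV[R]_m) (x v : 'rV[R]_n), domD g u -> 0 <= s <= 1 ->
    \sum_a xi a 0 ^+ 2 = 1 -> in_box c x ->
    e * (\sum_i v 0 i ^+ 2) <= qform (evalmx (curvmx q u s xi) x) v].
Proof.
have c0 : 0 < c by apply: lt_le_trans c1.
have [eta [B [eta0 B0 dich]]] := curvature_dichotomy.
(* A common bound for the g_k on the box. *)
pose gam := 1 + \sum_k sval (cid (tbounded_box (g k) c0)).
have gC k : 0 <= sval (cid (tbounded_box (g k) c0)).
  by have [d []] := svalP (cid (tbounded_box (g k) c0)).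
have gam0 : 0 < gam by rewrite ltr_pwDl // sumr_ge0.
have ggam x k : in_box c x -> `|evalp (g k) x| <= gam.
  move=> xb; have [d [_ bk]] := svalP (cid (tbounded_box (g k) c0)).
  apply: le_trans (tbounded_eval (fun i => boxvar_bounds i c0 xb) bk) _.
  rewrite /gam (bigD1 k) //= addrCA lerDl addr_ge0 // sumr_ge0 // => j _.
have [lam [p [lam0 pen]]] := penalty r eta0 B0 gam0.
pose q := \sum_k g k * (lam%:MP * ((1 - (gam^-1)%:MP * g k) ^+ p) ^+ 2).
have qE x : evalp q x =
    lam * \sum_k evalp (g k) x * ((1 - evalp (g k) x / gam) ^+ p) ^+ 2.
  rewrite /q evalp_sum mulr_sumr; apply: eq_bigr => k _.
  rewrite !evalpM evalpC !evalpX evalpB -mpolyC1 evalpC evalpM evalpC.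
  by rewrite [gam^-1 * _]mulrC mulrCA.
exists q, (eta / 2); split; first 1 last.
- by rewrite divr_gt0.
- move=> u s xi x v Du s01 xi1 xb; rewrite qform_curvmx.
  set S := \sum_i v 0 i ^+ 2.
  have S0 : 0 <= S by apply: sumr_ge0 => i _; apply: sqr_ge0.
  have [Sz|Sn] := eqVneq S 0.
    have -> : v = 0.
      apply/rowP => i; rewrite mxE; apply/eqP; rewrite -sqrf_eq0; apply/eqP.
      apply: (psumr_eq0P (P := xpredT) (F := fun i => v 0 i ^+ 2)) => // j _.
      exact: sqr_ge0.
    rewrite Sz !mulr0 -[X in curv _ _ X](scale0r (0 : 'rV[R]_n)) curvZ.
    by rewrite expr0n mul0r subr0.
  have Sp : 0 < S by rewrite lt_neqAle eq_sym Sn.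
  pose w := (Num.sqrt S)^-1 *: v.
  have w1 : \sum_i w 0 i ^+ 2 = 1.
    under eq_bigr do rewrite mxE exprMn.
    by rewrite -mulr_sumr -/S exprVn sqr_sqrtr // mulVf.
  have -> : v = Num.sqrt S *: w.
    by rewrite scalerA divff ?scale1r // gt_eqF // sqrtr_gt0.
  have [FB alt] := dich u s xi x w Du s01 xi1 xb w1.
  have := pen _ _ FB (fun k => ggam x k xb) alt; rewrite -qE => h.
  rewrite curvZ sqr_sqrtr // mulrC [evalp q x * S]mulrC -mulrBr.
  by rewrite ler_wpM2l.
rewrite /q; apply: quad_module_sum => k; rewrite -gextS.
apply: quad_moduleMsos; first exact: quad_module_gen.
by apply: sosM; [exact: sosC | exact: sos_sqr].
Qed.

End Dichotomy.
End Curvature.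

(** * The gradient inequality for linear functionals *)

Section GradientInequality.
Variables (R : realType) (n : nat).
Implicit Types (p q : {mpoly R[n]}) (u x : 'rV[R]_n).

Definition shiftvar u (i : 'I_n) : {mpoly R[n]} := 'X_i - (u 0 i)%:MP.

Lemma segpoly0 u p : segpoly u 0 p = (evalp p u)%:MP.
Proof.
elim/mpoly_ring_ind: p => [a|i|p q hp hq|p q hp hq].
- by rewrite segpolyC evalpC.
- by rewrite segpolyXU evalpXU subr0 mul1r scale0r addr0.
- by rewrite segpolyD evalpD hp hq mpolyCD.
- by rewrite segpolyM evalpM hp hq mpolyCM.
Qed.

Lemma segpoly1 u p : segpoly u 1 p = p.
Proof.
elim/mpoly_ring_ind: p => [a|i|p q hp hq|p q hp hq].
- by rewrite segpolyC.
- by rewrite segpolyXU subrr mul0r mpolyC0 scale1r add0r.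
- by rewrite segpolyD hp hq.
- by rewrite segpolyM hp hq.
Qed.

(** The polynomial p(u + s (X - u)) in the variable s, over the polynomials in X,
    together with the chain rule. *)
Lemma segline_exists u : exists F : {mpoly R[n]} -> {poly {mpoly R[n]}},
  (forall s p, (F p).[s%:MP] = segpoly u s p) /\
  (forall p, (F p)^`() = \sum_i F (mderiv i p) * (shiftvar u i)%:P).
Proof.
have [F [FD FM FC FX]] : exists F : {mpoly R[n]} -> {poly {mpoly R[n]}},
    [/\ {morph F : p q / p + q}, {morph F : p q / p * q},
        forall a, F a%:MP = (a%:MP)%:P
      & forall i, F 'X_i = ((u 0 i)%:MP)%:P + 'X * (shiftvar u i)%:P].
  exists (mmap [the {rmorphism R -> {poly {mpoly R[n]}}} of polyC \o @mpolyC n R]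
    (fun i => ((u 0 i)%:MP)%:P + 'X * (shiftvar u i)%:P)); split.
  - exact: mmapD.
  - exact: rmorphM.
  - exact: mmapC.
  - by move=> i; rewrite mmapX mmap1U.
have F0 : F 0 = 0 by rewrite -mpolyC0 FC mpolyC0 polyC0.
exists F; split=> [s p|p].
  elim/mpoly_ring_ind: p => [a|i|p q hp hq|p q hp hq].
  - by rewrite FC segpolyC hornerC.
  - rewrite FX segpolyXU !hornerE /shiftvar -mul_mpolyC mpolyCM mpolyCB mpolyC1.
    by ring.
  - by rewrite FD segpolyD hornerD hp hq.
  - by rewrite FM segpolyM hornerM hp hq.
elim/mpoly_ring_ind: p => [a|i|p q hp hq|p q hp hq].
- by rewrite FC derivC big1 // => j _; rewrite mderivC F0 mul0r.
- rewrite FX derivD derivC add0r derivM derivX derivC mul1r mulr0 addr0.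
  rewrite (bigD1 i) //= big1 => [|j ji]; rewrite mderivX mnm1E.
    have -> : (U_(i) - U_(i))%MM = 0%MM :> 'X_{1..n}.
      by apply/mnmP => l; rewrite mnmBE subnn mnm0E.
    by rewrite eqxx scale1r addr0 mpolyX0 -mpolyC1 FC mpolyC1 mul1r.
  by rewrite eq_sym (negPf ji) scale0r F0 mul0r.
- rewrite FD derivD hp hq -big_split; apply: eq_bigr => i _ /=.
  by rewrite mderivD FD mulrDl.
- rewrite FM derivM hp hq mulr_suml mulr_sumr -big_split.
  apply: eq_bigr => i _ /=.
  by rewrite mderivM FD !FM mulrDl; ring.
Qed.

Lemma horner_map_linear (L : {scalar {mpoly R[n]}}) (P : {poly {mpoly R[n]}}) s :
  (map_poly L P).[s] = L P.[s%:MP].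
Proof.
rewrite (horner_coef_wide _ (size_poly _ _)) horner_coef raddf_sum.
apply: eq_bigr => i _ /=; rewrite coef_map_id0 ?raddf0 //.
by rewrite -rmorphXn /= [in RHS]mulrC mul_mpolyC linearZ /= mulrC.
Qed.

Lemma deriv_map_linear (L : {scalar {mpoly R[n]}}) (P : {poly {mpoly R[n]}}) :
  (map_poly L P)^`() = map_poly L P^`().
Proof.
apply/polyP => i; rewrite coef_deriv !coef_map_id0 ?raddf0 //.
by rewrite coef_deriv raddfMn.
Qed.

Lemma concave_tangent (phi : {poly R}) :
  (forall s, 0 <= s <= 1 -> phi^`()^`().[s] <= 0) ->
  phi.[1] <= phi.[0] + phi^`().[0].
Proof.
move=> h; have [a a01 ha] := poly_mvt phi (@ltr01 R).
move: a01; rewrite in_itv /= => /andP[a0 a1].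
have [b b0a hb] := poly_mvt phi^`() a0.
move: b0a; rewrite in_itv /= => /andP[b0 ba].
have : phi^`()^`().[b] * (a - 0) <= 0.
  by rewrite subr0 mulr_le0_ge0 ?(ltW a0) // h // (ltW b0) ltW // (lt_trans ba).
by move: ha; rewrite -hb subr0 mulr1; lra.
Qed.

(** For s in [0, 1] put phi(s) = L(f((1 - s) u + s X)), a polynomial in s whose
    second derivative is the number assumed to be at most 0. Its graph lies
    below its tangent at 0. *)
Lemma gradient_ineq (L : {scalar {mpoly R[n]}}) f u :
  (forall s, 0 <= s <= 1 ->
     L (\sum_i \sum_j segpoly u s (mderiv j (mderiv i f)) *
          shiftvar u i * shiftvar u j) <= 0) ->
  L f <= evalp f u * L 1 + \sum_i evalp (mderiv i f) u * L (shiftvar u i).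
Proof.
move=> hess; have [F [F_eval F_deriv]] := segline_exists u.
pose phi := map_poly L (F f).
have d1 : phi^`() = map_poly L (\sum_i F (mderiv i f) * (shiftvar u i)%:P).
  by rewrite deriv_map_linear F_deriv.
have phi1 s : phi^`().[s] = \sum_i L (segpoly u s (mderiv i f) * shiftvar u i).
  rewrite d1 horner_map_linear horner_sum raddf_sum; apply: eq_bigr => i _ /=.
  by rewrite hornerM hornerC F_eval.
have phi2 s : 0 <= s <= 1 -> phi^`()^`().[s] <= 0.
  move=> /hess; rewrite d1 deriv_map_linear horner_map_linear.
  rewrite (raddf_sum (@deriv {mpoly R[n]})) horner_sum.
  congr (L _ <= 0); apply: eq_bigr => i _ /=.
  rewrite derivM derivC mulr0 addr0 F_deriv hornerM hornerC horner_sum mulr_suml.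
  by apply: eq_bigr => j _; rewrite hornerM hornerC F_eval mulrAC.
have := concave_tangent phi2; rewrite phi1 !horner_map_linear !F_eval segpoly1.
rewrite segpoly0 -[(evalp f u)%:MP]mulr1 mul_mpolyC linearZ /=.
congr (_ <= _ + _); apply: eq_bigr => i _.
by rewrite segpoly0 mul_mpolyC linearZ.
Qed.

End GradientInequality.

(** * A uniform certificate for the Hessians *)

Section HessianFunctional.
Variables (R : realType) (n m r : nat).
Variables (G : 'M[{mpoly R[n]}]_m) (g : 'I_r -> {mpoly R[n]}).

Lemma evalp_sos_ge0 (p : {mpoly R[n]}) x : sos p -> 0 <= evalp p x.
Proof.
by move=> [s ->]; rewrite evalp_sum; apply: sumr_ge0 => q _; rewrite evalpX sqr_ge0.
Qed.

Lemma msize_shiftvar_comb (u : 'rV[R]_n) (h : 'I_n -> R) :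
  (msize (\sum_i (h i)%:MP * shiftvar u i) <= 2)%N.
Proof.
apply: (leq_trans (msize_sum _ _ _)); apply/bigmax_leqP_seq => i _ _.
rewrite mul_mpolyC (leq_trans (msizeZ_le _ _)) //.
rewrite (leq_trans (msizeD_le _ _)) // geq_max msizeN msizeC msizeX mdeg1 /=.
by case: (_ == 0).
Qed.

Lemma curvmx_ubounded c q i j : 0 < c ->
  (forall x, domD g x -> in_box c x) ->
  ubounded c (fun th : 'rV[R]_n * R * 'cV[R]_m =>
      [/\ domD g th.1.1, 0 <= th.1.2 <= 1 & \sum_a th.2 a 0 ^+ 2 = 1])
    (fun th => curvmx G q th.1.1 th.1.2 th.2 i j).
Proof.
move=> c0 Dbox.
rewrite (_ : (fun _ => _) = fun th : 'rV[R]_n * R * 'cV[R]_m =>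
  - (\sum_a \sum_b (th.2 a 0 * th.2 b 0)%:MP *
     segpoly th.1.1 th.1.2 (mderiv j (mderiv i (G a b)))) + - (q *+ (i == j))).
  apply: uboundedD; last exact: ubounded_cst.
  apply: uboundedN => //; apply: ubounded_sum => // a; apply: ubounded_sum => // b.
  apply: uboundedM.
    apply: (@uboundedC _ _ _ _ _ _ 1) => // th [_ _ x1].
    rewrite normrM -[leRHS]mul1r ler_pM // ler_norml.
      exact: (sqsum_le1 (f := fun k => th.2 k 0)).
    exact: (sqsum_le1 (f := fun k => th.2 k 0)).
  by apply: segpoly_ubounded => // th [Du s01 _] //; apply: Dbox.
apply/funext => -[[u s] xi] /=; rewrite mxE hesspE.
have segS (F : 'I_m -> {mpoly R[n]}) :
    segpoly u s (\sum_a F a) = \sum_a segpoly u s (F a).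
  exact: raddf_sum.
congr (- _ + _); rewrite segS; apply: eq_bigr => a _; rewrite segS.
by apply: eq_bigr => b _; rewrite segpolyM segpolyC.
Qed.

(** The list Qs consists of the penalty q and of the Bernstein polynomials of
    some degree k. With w = X - u and A the opposite of the Hessian along the
    segment, w^T A w is the sum of the q w_i^2 and of Bernstein polynomials
    times squares of combinations of the w_i. *)
Lemma hessian_functional :
  convex_set (domD g : set (convex_lmodType 'rV[R]_n)) ->
  strictly_matrix_concave G (domD g) -> archimedean g ->
  exists Qs : seq {mpoly R[n]}, (forall q, q \in Qs -> quad_module g q) /\
    forall L : {scalar {mpoly R[n]}},
      (forall q, q \in Qs -> forall l, (msize l <= 2)%N -> 0 <= L (q * l ^+ 2)) ->
    forall u s (xi : 'cV[R]_m), domD g u -> 0 <= s <= 1 -> \sum_a xi a 0 ^+ 2 = 1 ->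
      L (\sum_i \sum_j segpoly u s (hessp G xi i j) *
          shiftvar u i * shiftvar u j) <= 0.
Proof.
move=> D_convex G_concave [M [M0 [s0 [sg [sos0 sosg archE]]]]].
pose c := M + 1; have c1 : 1 <= c by rewrite lerDr ltW.
have c0 : 0 < c by apply: lt_le_trans c1.
have Mc : M <= c ^+ 2 by rewrite /c; nra.
set rho := mpolyC n M - \sum_(i < n) 'X_i ^+ 2 in archE.
have Qrho : quad_module g rho.
  rewrite archE; apply: quad_moduleD; first exact: quad_module_sos.
  apply: quad_module_sum => k; rewrite -gextS.
  by apply: quad_moduleMsos => //; apply: quad_module_gen.
have Dbox x : domD g x -> in_box c x.
  move=> Dx i; have : 0 <= evalp rho x.
    rewrite archE evalpD evalp_sum addr_ge0 ?evalp_sos_ge0 // sumr_ge0 // => k _.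
    by rewrite evalpM mulr_ge0 // ?evalp_sos_ge0.
  rewrite evalpB evalpC evalp_sum (bigD1 i) //= evalpX evalpXU => h.
  have S0 : 0 <= \sum_(j < n | j != i) evalp ('X_j ^+ 2) x.
    by apply: sumr_ge0 => j _; rewrite evalpX sqr_ge0.
  have : x 0 i ^+ 2 <= c ^+ 2 by lra.
  by rewrite -ler_norml -real_normK ?num_real // ler_sqr ?nnegrE // ltW.
have [q [e [Qq e0 pen]]] := curvature_penalty c1 Dbox D_convex G_concave.
have bnd (ij : 'I_n * 'I_n) := curvmx_ubounded q ij.1 ij.2 c0 Dbox.
have [C [d [C0 Cd]]] := ubounded_fin bnd.
have [k cert] := psd_box_certificate n d c0 C0 e0.
exists (q :: [seq bernM nu (boxvar c) | nu <- enum {: {ffun 'I_n -> 'I_k.+1}}]); split.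
  move=> p; rewrite in_cons => /orP[/eqP -> //|/mapP[nu _ ->]].
  by apply: quad_module_preorder1 Qrho _; apply: bernM_preorder1.
move=> L posL u s xi Du s01 xi1.
have [//|i j|x v xb|cs csE] := cert (curvmx G q u s xi).
- exact: curvmx_sym.
- exact: (Cd (i, j) (u, s, xi) (And3 Du s01 xi1)).
- exact: pen.
pose w := shiftvar u.
have posw p :
    p \in q :: [seq bernM nu (boxvar c) | nu <- enum {: {ffun 'I_n -> 'I_k.+1}}] ->
    forall h : 'I_n -> R, 0 <= L (p * (\sum_i (h i)%:MP * w i) ^+ 2).
  by move=> pQ h; apply: posL => //; apply: msize_shiftvar_comb.
have -> : \sum_i \sum_j segpoly u s (hessp G xi i j) * w i * w j =
  - (\sum_i q * (w i) ^+ 2 + \sum_nu \sum_(h <- cs nu)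
      bernM nu (boxvar c) * (\sum_i (h 0 i)%:MP * w i) ^+ 2).
  (* A coefficient matrix h^T h contributes the square of h . w. *)
  have E1 nu (h : 'rV[R]_n) : bernM nu (boxvar c) * (\sum_i (h 0 i)%:MP * w i) ^+ 2 =
      \sum_i \sum_j ((h 0 i * h 0 j) *: bernM nu (boxvar c)) * w i * w j.
    rewrite expr2 mulr_suml mulr_sumr; apply: eq_bigr => i _.
    rewrite !mulr_sumr; apply: eq_bigr => j _.
    by rewrite -mul_mpolyC mpolyCM; ring.
  have E2 : \sum_nu \sum_(h <- cs nu)
      bernM nu (boxvar c) * (\sum_i (h 0 i)%:MP * w i) ^+ 2 =
      \sum_i \sum_j curvmx G q u s xi i j * w i * w j.
    under eq_bigr => nu _ do under eq_bigr => h _ do rewrite E1.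
    under eq_bigr => nu _.
      rewrite exchange_big /=; under eq_bigr => i _ do rewrite exchange_big /=.
      over.
    rewrite exchange_big; apply: eq_bigr => i _ /=.
    rewrite exchange_big; apply: eq_bigr => j _ /=.
    rewrite csE !mulr_suml; apply: eq_bigr => nu _.
    by rewrite scaler_suml !mulr_suml.
  rewrite E2 opprD -!sumrN -big_split; apply: eq_bigr => i _ /=.
  have -> : q * w i ^+ 2 = \sum_j (q *+ (i == j)) * w i * w j.
    rewrite (bigD1 i) //= eqxx big1 => [|j].
      by rewrite mulr1n addr0; ring.
    by rewrite eq_sym => /negPf ->; rewrite mulr0n !mul0r.
  rewrite -!sumrN -big_split; apply: eq_bigr => j _ /=.
  by rewrite mxE; ring.
rewrite raddfN oppr_le0 raddfD addr_ge0 // raddf_sum sumr_ge0 //= => [i|nu] _.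
  have := posw q (mem_head _ _) (fun j => (j == i)%:R).
  rewrite (bigD1 i) //= eqxx mpolyC1 mul1r big1 ?addr0 // => j /negPf ->.
  by rewrite mpolyC0 mul0r.
rewrite raddf_sum sumr_ge0 // => h _; apply: posw.
by rewrite in_cons; apply/orP; right; apply/mapP; exists nu; rewrite ?mem_enum.
Qed.

End HessianFunctional.

(** * Pseudo-moments *)

Section MomentFunctional.
Variables (R : realType) (n N : nat) (y : 'X_{1..n < (2 * N).+1} -> R).

(** The Riesz functional, extended by 0 to the monomials of degree above 2N, so
    that it is linear on all polynomials. *)
Definition riesz (p : {mpoly R[n]}) : R :=
  \sum_(b : 'X_{1..n < (2 * N).+1}) y b * p@_(bmnm b).

Lemma riesz_is_linear : scalar riesz.
Proof.
move=> a p q; rewrite /riesz mulr_sumr -big_split; apply: eq_bigr => b _ /=.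
by rewrite mcoeffD mcoeffZ; ring.
Qed.

HB.instance Definition _ :=
  GRing.isLinear.Build R {mpoly R[n]} R _ riesz riesz_is_linear.

Lemma rieszX (b : 'X_{1..n < (2 * N).+1}) : riesz 'X_[bmnm b] = y b.
Proof.
rewrite /riesz (bigD1 b) //= mcoeffX eqxx mulr1 big1 ?addr0 // => a ab.
by rewrite mcoeffX (inj_eq val_inj) eq_sym (negPf ab) mulr0.
Qed.

Lemma Gmx_riesz m (G : 'M[{mpoly R[n]}]_m) i j : Gmx G y i j = riesz (G i j).
Proof. by rewrite /Gmx summxE; apply: eq_bigr => b _; rewrite !mxE. Qed.

Lemma Bmx_riesz r (g : 'I_r -> {mpoly R[n]}) k i j :
  Bmx g k y i j = riesz (gext g k * ('X_[bmnm (enum_val i)] * 'X_[bmnm (enum_val j)])).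
Proof.
rewrite /Bmx summxE; apply: eq_bigr => b _; rewrite !mxE big_ord1 !mxE.
by [].
Qed.

Lemma riesz_quadform m (G : 'M[{mpoly R[n]}]_m) (xi : 'cV[R]_m) :
  riesz (quadform G xi) = (xi^T *m Gmx G y *m xi) 0 0.
Proof.
rewrite quadformE mxE; under [RHS]eq_bigr do rewrite mxE mulr_suml.
rewrite exchange_big raddf_sum; apply: eq_bigr => a _ /=.
rewrite raddf_sum; apply: eq_bigr => b _ /=.
by rewrite mul_mpolyC linearZ /= Gmx_riesz !mxE; ring.
Qed.

(** The localizing matrix, evaluated at the vector of coefficients of p. *)
Lemma riesz_gext_sqr r (g : 'I_r -> {mpoly R[n]}) k (p : {mpoly R[n]}) :
  psd (Bmx g k y) -> (msize p <= (N - dk g k).+1)%N ->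
  0 <= riesz (gext g k * p ^+ 2).
Proof.
move=> [_ psdB] szp.
pose v := \col_(i < #|{: 'X_{1..n < (N - dk g k).+1}}|) p@_(bmnm (enum_val i)).
have pE : p = \sum_i v i 0 *: 'X_[bmnm (enum_val i)].
  rewrite {1}(mpolywE szp).
  rewrite (eq_bigl (mem {: 'X_{1..n < (N - dk g k).+1}})) // big_enum_val.
  by apply: eq_bigr => i _; rewrite mxE.
have := psdB v; congr (0 <= _); rewrite mxE.
under eq_bigr do rewrite mxE mulr_suml.
rewrite pE expr2 mulr_suml mulr_sumr exchange_big raddf_sum; apply: eq_bigr => i _ /=.
rewrite !mulr_sumr raddf_sum; apply: eq_bigr => j _ /=.
rewrite Bmx_riesz mxE -!mul_mpolyC.
set X := 'X_[_]; set Y := 'X_[_].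
have -> : gext g k * ((v i 0)%:MP * X * ((v j 0)%:MP * Y)) =
    (v i 0 * v j 0)%:MP * (gext g k * (X * Y)) by rewrite mpolyCM; ring.
by rewrite mul_mpolyC linearZ /=; ring.
Qed.

End MomentFunctional.

Section Orders.
Variables (R : realType) (n m r : nat).
Variables (G : 'M[{mpoly R[n]}]_m) (g : 'I_r -> {mpoly R[n]}).

Lemma riesz_quad_module q : quad_module g q ->
  exists N0, forall N, (N0 <= N)%N -> forall y : 'X_{1..n < (2 * N).+1} -> R,
    (forall k, psd (Bmx g k y)) -> forall l, (msize l <= 2)%N ->
    0 <= riesz y (q * l ^+ 2).
Proof.
move=> [s [soss ->]].
pose sq k := sval (cid (soss k)).
have sqE k : s k = \sum_(f <- sq k) f ^+ 2 by exact: svalP (cid (soss k)).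
(* The sum of the sizes bounds each of them; the 3 accounts for an affine
   factor and for the slack in the bound on the size of a product. *)
pose D k := (dk g k + \sum_(f <- sq k) msize f + 3)%N.
exists (\sum_k D k)%N => N N0 y By l szl.
rewrite mulr_suml raddf_sum sumr_ge0 //= => k _.
rewrite sqE mulr_sumr mulr_suml raddf_sum big_seq sumr_ge0 //= => f fs.
rewrite -mulrA -exprMn; apply: riesz_gext_sqr => //.
have Dk : (D k <= N)%N by rewrite (leq_trans _ N0) // (bigD1 k) //= leq_addr.
have szf : (msize f <= \sum_(f <- sq k) msize f)%N.
  by rewrite (big_rem f) //= leq_addr.
apply: leq_trans (msizeM_le f l) _; apply: leqW.
rewrite leq_subRL; last by apply: leq_trans Dk; rewrite /D -addnA leq_addr.
by move: Dk szf szl; rewrite /D; move: (\sum_(_ <- _) _)%N (mmeasure _ f) (mmeasure _ l); lia.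
Qed.

Lemma riesz_quad_modules (Qs : seq {mpoly R[n]}) :
  (forall q, q \in Qs -> quad_module g q) ->
  exists N0, forall N, (N0 <= N)%N -> forall y : 'X_{1..n < (2 * N).+1} -> R,
    (forall k, psd (Bmx g k y)) -> forall q, q \in Qs ->
    forall l, (msize l <= 2)%N -> 0 <= riesz y (q * l ^+ 2).
Proof.
elim: Qs => [|q Qs IH] QQ; first by exists 0%N.
have [N1 h1] := riesz_quad_module (QQ q (mem_head _ _)).
have [|N2 h2] := IH; first by move=> p pQ; apply: QQ; rewrite in_cons pQ orbT.
exists (N1 + N2)%N => N leN y By p; rewrite in_cons => /orP[/eqP ->|].
  by apply: h1 => //; apply: leq_trans leN; apply: leq_addr.
by apply: h2 => //; apply: leq_trans leN; apply: leq_addl.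
Qed.

Lemma riesz_point N (x : 'rV[R]_n) (p : {mpoly R[n]}) (a : 'X_{1..n}) :
  (mpdeg p + mdeg a <= 2 * N)%N ->
  riesz (fun b : 'X_{1..n < (2 * N).+1} => evalp 'X_[bmnm b] x) (p * 'X_[a]) =
  evalp (p * 'X_[a]) x.
Proof.
move=> deg; rewrite (mpolyE p) mulr_suml evalp_sum raddf_sum !big_seq.
apply: eq_bigr => b bp /=; rewrite -scalerAl linearZ /= -mul_mpolyC.
rewrite evalpM evalpC -mpolyXD; congr (_ * _).
have ab : (mdeg (b + a) < (2 * N).+1)%N.
  rewrite mdegD ltnS (leq_trans _ deg) // leq_add2r /mpdeg.
  by have := msize_mdeg_lt bp; case: (msize p).
exact: (rieszX _ (BMultinom ab)).
Qed.

Lemma evalp_quadform (xi : 'cV[R]_m) x :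
  evalp (quadform G xi) x = (xi^T *m evalmx G x *m xi) 0 0.
Proof.
rewrite quadformE mxE; under [RHS]eq_bigr do rewrite mxE mulr_suml.
rewrite exchange_big evalp_sum; apply: eq_bigr => a _ /=.
rewrite evalp_sum; apply: eq_bigr => b _ /=.
by rewrite evalpM evalpC !mxE; ring.
Qed.

Lemma rank1_form k (B : 'M[R]_k) a (f : 'I_k -> R) :
  (forall i j, B i j = a * (f i * f j)) ->
  forall v : 'cV[R]_k, (v^T *m B *m v) 0 0 = a * (\sum_i v i 0 * f i) ^+ 2.
Proof.
move=> BE v; rewrite mxE; under eq_bigr do rewrite mxE mulr_suml.
rewrite expr2 mulr_sumr mulr_sumr; apply: eq_bigr => j _.
rewrite !mulr_suml mulr_sumr; apply: eq_bigr => i _.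
by rewrite BE mxE; ring.
Qed.

(** The monomials of x are feasible: G(y) = G(x), and each localizing matrix is
    g_k(x) times the outer product of the vector of monomials of x. *)
Lemma setS_sub_setL N : (forall k, dk g k <= N)%N -> (mxdeg G <= N)%N ->
  setS G g `<=` setL G g N.
Proof.
move=> dN GN x [Dx psdG].
pose y (b : 'X_{1..n < (2 * N).+1}) := evalp ('X_[bmnm b] : {mpoly R[n]}) x.
have BE k i j : Bmx g k y i j = evalp (gext g k) x *
    (evalp 'X_[bmnm (enum_val i)] x * evalp 'X_[bmnm (enum_val j)] x).
  rewrite Bmx_riesz -mpolyXD riesz_point ?evalpM ?mpolyXD ?evalpM //.
  rewrite mdegD; have := bmdeg (enum_val i); have := bmdeg (enum_val j).
  have := dN k; rewrite /dk; have := uphalf_half (mpdeg (gext g k)).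
  have := odd_double_half (mpdeg (gext g k)).
  case: odd => /=; lia.
exists y; split.
- by move=> b b0; rewrite /y b0 mpolyX0 -mpolyC1 evalpC.
- by move=> i b bi; rewrite /y bi evalpXU.
- suff -> : Gmx G y = evalmx G x by [].
  apply/matrixP => i j; rewrite Gmx_riesz mxE -[G i j]mulr1 -(mpolyX0 n R).
  apply: riesz_point; rewrite mdeg0 addn0.
  have : (mpdeg (G i j) <= mxdeg G)%N.
    by rewrite /mxdeg (bigD1 i) //= (bigD1 j) //= !leq_max leqnn.
  lia.
- move=> k; split.
    by apply/matrixP => i j; rewrite mxE !BE; ring.
  have gx : 0 <= evalp (gext g k) x.
    by rewrite /gext; case: unliftP => [l _|_] /=; [exact: Dx | rewrite -mpolyC1 evalpC].
  move=> v; rewrite (rank1_form (BE k)).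
  by rewrite mulr_ge0 ?sqr_ge0.
Qed.

Lemma order_bound_le N : (forall k, dk g k <= N)%N -> (mxdeg G <= N)%N ->
  order_bound G g <= N%:R.
Proof.
move=> dN GN; rewrite /order_bound; apply: (big_ind (fun z => z <= N%:R)).
- have : (mxdeg G)%:R <= N%:R :> rat by rewrite ler_nat.
  by have := ler0n rat N; lra.
- by move=> a b aN bN; rewrite ge_max aN.
- by move=> k _; rewrite ler_nat.
Qed.

End Orders.

(** * Leaving the domain along a segment *)

Section Exit.
Variables (R : realType) (n m r : nat).
Variables (G : 'M[{mpoly R[n]}]_m) (g : 'I_r -> {mpoly R[n]}).
Implicit Types u x : 'rV[R]_n.

Lemma seg_univariate u x (p : {mpoly R[n]}) :
  exists phi : {poly R}, forall s, phi.[s] = evalp p ((1 - s) *: u + s *: x).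
Proof.
have [F [F_eval _]] := segline_exists u.
exists (map_poly [the {scalar {mpoly R[n]}} of meval (fun i => x 0 i)] (F p)) => s.
by rewrite horner_map_linear F_eval -evalp_segpoly.
Qed.

Lemma last_point_in_domD u x : domD g u ->
  let z s := (1 - s) *: u + s *: x in
  exists tau, [/\ 0 <= tau <= 1, domD g (z tau) &
    forall s, 0 <= s <= 1 -> domD g (z s) -> s <= tau].
Proof.
move=> Du z; pose T : set R := [set s | 0 <= s <= 1 /\ domD g (z s)].
have T0 : T 0.
  by split; [rewrite lexx ler01 | rewrite /z subr0 scale1r scale0r addr0].
have ubT : has_ubound T by exists 1 => s [/andP[]].
have supT : has_sup T by split; [exists 0 | exact: ubT].
have tau0 : 0 <= sup T by apply: ub_le_sup.
have tau1 : sup T <= 1 by apply: ge_sup; [exists 0 | move=> s [/andP[]]].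
exists (sup T); split; first by rewrite tau0.
  move=> k; rewrite leNgt; apply/negP => neg.
  have [phi phiE] := seg_univariate u x (g k).
  have e0 : 0 < - phi.[sup T] by rewrite phiE oppr_gt0.
  have [d d0 hd] := poly_cont (sup T) phi e0.
  have [s Ts ds] := sup_adherent d0 supT.
  have sT : s <= sup T by apply: ub_le_sup.
  have : `|s - sup T| < d by rewrite ler0_norm ?subr_le0 // opprB; lra.
  move/hd; rewrite ltr_norml => /andP[_ h].
  by have [_ /(_ k)] := Ts; rewrite -phiE; lra.
by move=> s s01 Ds; apply: ub_le_sup.
Qed.

(** Take the last point of the segment in D. It is not in S: either it is x, or
    else it would be interior to D and the segment would stay in D a little
    longer. *)
Lemma segment_exit u x : setS G g `<=` interior (domD g) ->
  domD g u -> ~ setS G g x ->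
  exists s, [/\ 0 <= s <= 1, domD g ((1 - s) *: u + s *: x) &
    ~ setS G g ((1 - s) *: u + s *: x)].
Proof.
move=> S_int Du nSx; have [tau [/andP[tau0 tau1] Dz tau_max]] := last_point_in_domD x Du.
exists tau; split; rewrite ?tau0 // => Sz.
have [tauE|tau_n1] := eqVneq tau 1.
  by apply: nSx; move: Sz; rewrite tauE subrr scale0r scale1r add0r.
have tau_lt1 : tau < 1 by rewrite lt_neqAle tau_n1.
have := S_int _ Sz; rewrite /interior => /nbhs_ballP[e /= e0 eD].
(* A step of length d in s moves the point by less than e. *)
pose K := 1 + \sum_j `|x 0 j - u 0 j|.
have K0 : 0 < K by rewrite ltr_pwDl // sumr_ge0.
pose d := Num.min (1 - tau) (e / (2 * K)).
have d0 : 0 < d by rewrite lt_min subr_gt0 tau_lt1 divr_gt0 // mulr_gt0.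
have d1 : d <= 1 - tau by rewrite ge_min lexx.
have dK : d * K < e.
  have : d <= e / (2 * K) by rewrite ge_min lexx orbT.
  by rewrite ler_pdivlMr ?mulr_gt0 // => h; lra.
suff : tau + d <= tau by lra.
apply: tau_max; first by apply/andP; split; lra.
apply: eD; split=> // i j; rewrite (ord1 i) /ball /= !mxE.
have -> : (1 - tau) * u 0 j + tau * x 0 j -
   ((1 - (tau + d)) * u 0 j + (tau + d) * x 0 j) = - (d * (x 0 j - u 0 j)) by ring.
rewrite normrN normrM gtr0_norm //; apply: le_lt_trans dK.
rewrite ler_wpM2l ?(ltW d0) // /K (bigD1 j) //= addrCA lerDl addr_ge0 // sumr_ge0 //.
Qed.

End Exit.

Section Separation.
Variables (R : realType) (n m r : nat).
Variables (G : 'M[{mpoly R[n]}]_m) (g : 'I_r -> {mpoly R[n]}).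
Hypothesis Gsym : G^T = G.

Lemma not_setS_direction u : domD g u -> ~ setS G g u ->
  exists xi : 'cV[R]_m, \sum_a xi a 0 ^+ 2 = 1 /\ evalp (quadform G xi) u < 0.
Proof.
move=> Du nSu; have [v v_neg] : exists v : 'cV[R]_m, evalp (quadform G v) u < 0.
  apply: contrapT => nv; apply: nSu; split=> //; split.
    by rewrite -[in RHS]Gsym /evalmx map_trmx.
  move=> v; rewrite -evalp_quadform leNgt; apply/negP => hv.
  by apply: nv; exists v.
set S := \sum_a v a 0 ^+ 2.
have S0 : 0 < S.
  rewrite lt_neqAle sumr_ge0 ?andbT => [|a _]; last exact: sqr_ge0.
  apply/eqP => S0; move: v_neg; rewrite quadformE evalp_sum big1 ?ltxx // => a _.
  rewrite evalp_sum big1 // => b _; rewrite evalpM evalpC.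
  suff -> : v a 0 = 0 by rewrite !mul0r.
  apply/eqP; rewrite -sqrf_eq0; apply/eqP.
  apply: (psumr_eq0P (P := xpredT) (F := fun i => v i 0 ^+ 2)) => // i _.
  exact: sqr_ge0.
exists ((Num.sqrt S)^-1 *: v); split.
  under eq_bigr do rewrite mxE exprMn.
  by rewrite -mulr_sumr -/S exprVn sqr_sqrtr ?(ltW S0) // mulVf // gt_eqF.
have -> : quadform G ((Num.sqrt S)^-1 *: v) = (S^-1)%:MP * quadform G v.
  rewrite !quadformE mulr_sumr; apply: eq_bigr => a _.
  rewrite mulr_sumr; apply: eq_bigr => b _; rewrite !mxE [RHS]mulrA -mpolyCM.
  congr (_%:MP * _); rewrite -[in RHS](sqr_sqrtr (ltW S0)).
  by rewrite expr2 invfM; ring.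
by rewrite evalpM evalpC pmulr_rlt0 // invr_gt0.
Qed.

Hypothesis G_concave : strictly_matrix_concave G (domD g).
Hypothesis D_convex : convex_set (domD g : set (convex_lmodType 'rV[R]_n)).

Lemma point_hessian (x u : 'rV[R]_n) s (xi : 'cV[R]_m) :
  domD g x -> domD g u -> 0 <= s <= 1 -> xi != 0 ->
  evalp (\sum_i \sum_j segpoly u s (hessp G xi i j) *
          shiftvar u i * shiftvar u j) x <= 0.
Proof.
move=> Dx Du s01 xi0.
have -> : evalp (\sum_i \sum_j segpoly u s (hessp G xi i j) *
     shiftvar u i * shiftvar u j) x = - curv G xi ((1 - s) *: u + s *: x) (x - u).
  rewrite /curv opprK evalp_sum; apply: eq_bigr => i _.
  rewrite evalp_sum; apply: eq_bigr => j _.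
  by rewrite !evalpM evalp_segpoly /shiftvar !evalpB !evalpXU !evalpC !mxE.
rewrite oppr_le0; have [->|v0] := eqVneq (x - u) 0.
  by rewrite -(scale0r (0 : 'rV[R]_n)) curvZ expr0n mul0r.
by apply: ltW; apply: curv_gt0 G_concave _ _ _ => //; apply: convex_seg.
Qed.

(** At a point u of the segment with f(u) < 0, the tangent of f must rise towards
    xt, by concavity at xt, and towards x, by the gradient inequality for the
    Riesz functional; these directions are opposite. *)
Lemma setL_sub_setS (xt : 'rV[R]_n) N (y : 'X_{1..n < (2 * N).+1} -> R)
    (x : 'rV[R]_n) :
  setS G g `<=` interior (domD g) -> domD g xt -> psd (evalmx G xt) ->
  riesz y 1 = 1 -> (forall i, riesz y 'X_i = x 0 i) -> psd (Gmx G y) ->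
  (forall u s (xi : 'cV[R]_m), domD g u -> 0 <= s <= 1 ->
     \sum_a xi a 0 ^+ 2 = 1 ->
     riesz y (\sum_i \sum_j segpoly u s (hessp G xi i j) *
          shiftvar u i * shiftvar u j) <= 0) ->
  setS G g x.
Proof.
move=> S_int Dxt [_ psdxt] y1 yX [_ psdGy] hess; apply: contrapT => nSx.
have [s [s01 Du nSu]] := segment_exit S_int Dxt nSx.
set u := _ + _ in Du nSu.
have [xi [xi1 f_neg]] := not_setS_direction Du nSu.
have xi0 : xi != 0.
  apply/eqP => xi0; move: xi1; rewrite xi0 big1 => [/eqP|a _].
    by rewrite eq_sym oner_eq0.
  by rewrite mxE expr0n.
set f := quadform G xi in f_neg.
pose A := \sum_i evalp (mderiv i f) u * (x 0 i - xt 0 i).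
have := gradient_ineq (fun t t01 => hess u t xi Du t01 xi1).
rewrite /= -/f y1 mulr1 riesz_quadform => h1.
have := @gradient_ineq _ _ [the {scalar {mpoly R[n]}} of meval (fun i => xt 0 i)] f u
  (fun t t01 => point_hessian Dxt Du t01 xi0).
rewrite /= meval1 mulr1 -/(evalp f xt) evalp_quadform => h2.
have := psdGy xi; have := psdxt xi => p2 p1.
have sum1 : \sum_i evalp (mderiv i f) u * riesz y (shiftvar u i) = (1 - s) * A.
  rewrite mulr_sumr; apply: eq_bigr => i _.
  rewrite raddfB /= yX -[(u 0 i)%:MP]mulr1 mul_mpolyC linearZ /= y1 mulr1.
  by rewrite /u !mxE; ring.
have sum2 : \sum_i evalp (mderiv i f) u * (shiftvar u i).@[fun i0 => xt 0 i0] = - (s * A).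
  rewrite mulr_sumr -sumrN; apply: eq_bigr => i _.
  rewrite -/(evalp _ xt) evalpB evalpXU evalpC.
  by rewrite /u !mxE; ring.
rewrite sum1 in h1; rewrite sum2 in h2.
case/andP: s01 => s0 s1; have sA : s * A < 0 by lra.
have A0 : A < 0 by nra.
have : (1 - s) * A <= 0 by rewrite mulr_ge0_le0 ?subr_ge0 ?(ltW A0).
by lra.
Qed.

End Separation.

(** * Exactness of the relaxation *)

Theorem corollary3p3 (R : realType) (n m r : nat)
    (G : 'M[{mpoly R[n]}]_m) (g : 'I_r -> {mpoly R[n]})
    (Gsym : G^T = G)
    (S_int : setS G g `<=` interior (domD g))
    (D_convex : convex_set (domD g : set (convex_lmodType 'rV[R]_n)))
    (slater : exists x, domD g x /\ posdef (evalmx G x))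
    (G_concave : strictly_matrix_concave G (domD g))
    (D_arch : archimedean g) :
  exists Nstar : nat, order_bound G g <= Nstar%:R /\
    forall N : nat, (Nstar <= N)%N -> setS G g = setL G g N.
Proof.
have [Qs [QsP hess]] := hessian_functional D_convex G_concave D_arch.
have [N0 posQs] := riesz_quad_modules QsP.
have [xt [Dxt [symGt posGt]]] := slater.
have psdGt : psd (evalmx G xt).
  split=> // v; have [->|/posGt/ltW //] := eqVneq v 0.
  by rewrite mulmx0 mxE.
pose Nstar := (N0 + (\sum_k dk g k + mxdeg G) + 1)%N.
have dN N k : (Nstar <= N)%N -> (dk g k <= N)%N.
  by apply: leq_trans; rewrite /Nstar (bigD1 k) //=; lia.
have GN N : (Nstar <= N)%N -> (mxdeg G <= N)%N.
  by apply: leq_trans; rewrite /Nstar; lia.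
exists Nstar; split.
  by apply: order_bound_le => [k|]; [exact: dN | exact: GN].
move=> N leN; apply/seteqP; split.
  by apply: setS_sub_setL => [k|]; [exact: dN | exact: GN].
move=> x [y [y0 yU psdG psdB]].
have N0le : (N0 <= N)%N by apply: leq_trans leN; rewrite /Nstar; lia.
have deg1 (i : 'I_n) : (mdeg U_(i)%MM < (2 * N).+1)%N.
  by rewrite mdeg1; move: leN; rewrite /Nstar; lia.
have deg0 : (mdeg (0%MM : 'X_{1..n}) < (2 * N).+1)%N by rewrite mdeg0.
apply: (setL_sub_setS Gsym G_concave D_convex (y := y) S_int Dxt psdGt) => //.
- rewrite -(mpolyX0 n R); have := rieszX y (BMultinom deg0) => /= ->.
  exact: y0.
- move=> i; have := rieszX y (BMultinom (deg1 i)) => /= ->.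
  by rewrite (yU i (BMultinom (deg1 i))).
- by move=> u s xi Du s01 xi1; apply: hess => //; apply: posQs.
Qed.
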